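(* For the noncommutative conics $A=S/(f)$ with $S\in\{\mathcal{S},\mathcal{S}',\mathcal{N}\}$ and $f$ as listed below ($\alpha,\beta\in k$), the quadratic dual $A^!$ and the algebra $C(A)$ are, up to isomorphism, as follows. Here $B^{\times2}$ denotes $B\times B$. For $S=\mathcal{S}$: - $f=x^2$: $A^!=k[x,y,z]/(y^2,z^2)$ and $C(A)\cong k[u,v]/(u^2,v^2)$. - $f=x^2+y^2$: $A^!=k[x,y,z]/(x^2-y^2,z^2)$ and $C(A)\cong (k[u]/(u^2))^{\times2}$. - $f=x^2+y^2+z^2$: $A^!=k[x,y,z]/(x^2-y^2,x^2-z^2)$ and $C(A)\cong k^4$. For $S=\mathcal{S}'$: - $f=x^2$: $A^!=k[x,y,z]/(y^2,z^2)$ and $C(A)\cong k[u,v]/(u^2,v^2)$. - $f=y^2$: $A^!=k[x,y,z]/(x^2-yz,z^2)$ and $C(A)\cong k[u]/(u^4)$. - $f=x^2+y^2$: $A^!=k[x,y,z]/(x^2-yz-y^2,z^2)$ and $C(A)\cong(k[u]/(u^2))^{\times2}$. - $f=\alpha x^2+y^2+z^2$: $A^!=k[x,y,z]/(y^2-z^2,\ x^2-yz-\alpha y^2)$, and $C(A)\cong k[u]/(u^2)\times k^2$ if $\alpha=\pm1$, while $C(A)\cong k^4$ if $\alpha\neq\pm1$. For $S=\mathcal{N}$: - $f=\alpha x^2+y^2$: $A^!=k[x,y,z]/(x^2-yz-\alpha(y^2-xz),\ z^2)$, and $C(A)\cong k[u]/(u^4)$ if $\alpha=0$, while $C(A)\cong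 (k[u]/(u^2))^{\times2}$ if $\alpha\neq0$. - $f=\alpha x^2+\beta y^2+z^2$: $A^!=k[x,y,z]/(x^2-yz-\alpha z^2,\ y^2-xz-\beta z^2)$, and $C(A)\cong k^4$ if $\Delta_{\alpha,\beta}\neq0$; $C(A)\cong k[u]/(u^3)\times k$ if $\alpha=\frac34\mu$ and $\beta=\frac34\mu^2$ for some $\mu\in k$ with $\mu^3=1$; $C(A)\cong k[u]/(u^2)\times k^2$ otherwise. Here $\Delta_{\alpha,\beta}$ is the discriminant of the quartic polynomial $u^4-2\beta u^2-u-\alpha+\beta^2$ in $u$, namely $$\Delta_{\alpha,\beta}=-27-256\alpha^3+288\alpha\beta+256\alpha^2\beta^2-256\beta^3.$$
   Context: Let $k$ be an algebraically closed field of characteristic zero. With $x,y,z$ in degree $1$, put $$\mathcal{S}=k\langle x,y,z\rangle/(xy+yx,\ yz+zy,\ zx+xz),$$ $$\mathcal{S}'=k\langle x,y,z\rangle/(xy+yx,\ yz+zy+x^2,\ zx+xz),$$ $$\mathcal{N}=k\langle x,y,z\rangle/(xy+yx,\ yz+zy+x^2,\ zx+xz+y^2).$$ These are $3$-dimensional quantum polynomial algebras, and the listed elements $f$ are central and regular of degree $2$; the quotient $A=S/(f)$ is a noncommutative conic. For a quadratic algebra $A=T(V)/(R)$, $R\subset V\otimes V$, the quadratic dual is $A^!=T(V^* )/(R^\perp)$, with $R^\perp\subset V^*\otimes V^*$ the orthogonal complement of $R$. In the descriptions of $A^!$ the dual basis elements $x^*,y^*,z^*$ are again denoted $x,y,z$.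 For $A=S/(f)$ there is a central regular element $f^!\in A^!_2$, unique up to scalar, such that $A^!/(f^!)=S^!$. The algebra $C(A)$ is the degree-zero part of the localization of $A^!$ at $f^!$: $C(A)=A^![(f^!)^{-1}]_0$. *)

(* Defs.v *)
From HB Require Import structures.
From mathcomp Require Import all_boot all_order all_algebra.
From mathcomp Require Import boolp.
From mathcomp Require Import finmap.
From mathcomp.multinomials Require Import monalg.

Set Implicit Arguments.
Unset Strict Implicit.
Unset Printing Implicit Defensive.

Import GRing.Theory.
Local Open Scope ring_scope.
Local Open Scope quotient_scope.

Definition alg_iso (k : fieldType) (A B : algType k) : Prop :=
  exists f : {lrmorphism A -> B}, bijective f.

Section Ideal.
Variables (k : fieldType) (A : algType k).

(* the two-sided ideal generated by G *)
Inductive ideal (G : A -> Prop) : A -> Prop :=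
| ideal_gen g of G g : ideal G g
| ideal_zero : ideal G 0
| ideal_add a b of ideal G a & ideal G b : ideal G (a + b)
| ideal_mull c a of ideal G a : ideal G (c * a)
| ideal_mulr a c of ideal G a : ideal G (a * c).

Variable G : A -> Prop.

Lemma ideal_opp a : ideal G a -> ideal G (- a).
Proof. by move=> Ga; rewrite -mulN1r; apply: ideal_mull. Qed.

Lemma ideal_scale c a : ideal G a -> ideal G (c *: a).
Proof. by move=> Ga; rewrite -[a]mul1r scalerAl; apply: ideal_mull. Qed.

Lemma ideal_ker (C : nzRingType) (e : {rmorphism A -> C}) a :
  (forall g, G g -> e g = 0) -> ideal G a -> e a = 0.
Proof.
move=> eG; elim=> [g /eG//||b c _ eb _ ec|c b _ eb|b c _ eb].
- exact: rmorph0.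
- by rewrite rmorphD eb ec addr0.
- by rewrite rmorphM eb mulr0.
- by rewrite rmorphM eb mul0r.
Qed.

Lemma ideal_proper (C : nzRingType) (e : {rmorphism A -> C}) :
  (forall g, G g -> e g = 0) -> ~ ideal G 1.
Proof. by move=> eG /(ideal_ker eG)/eqP; rewrite rmorph1 oner_eq0. Qed.

End Ideal.

(* MathComp algebras are nontrivial, so the quotient A / (G) takes a proof that
   the ideal (G) is proper. *)
Section Quotient.
Variables (k : fieldType) (A : algType k) (G : A -> Prop).

Definition quot_rel : rel A := fun a b => `[< ideal G (a - b) >].

Lemma quot_rel_refl : reflexive quot_rel.
Proof. by move=> a; apply/asboolP; rewrite subrr; apply: ideal_zero. Qed.

Lemma quot_rel_sym : ssrbool.symmetric quot_rel.
Proof.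
suff imp a b : quot_rel a b -> quot_rel b a by move=> a b; apply/idP/idP => /imp.
by move=> /asboolP Gab; apply/asboolP; rewrite -opprB; apply: ideal_opp.
Qed.

Lemma quot_rel_trans : transitive quot_rel.
Proof.
move=> b a c /asboolP Gab /asboolP Gbc; apply/asboolP.
by rewrite -[a](subrK b) -addrA; apply: ideal_add.
Qed.

Canonical quot_equiv :=
  EquivRel quot_rel quot_rel_refl quot_rel_sym quot_rel_trans.

Definition quot (proper : ~ ideal G 1) := {eq_quot quot_equiv}.

Variable proper : ~ ideal G 1.
Local Notation Q := (quot proper).

HB.instance Definition _ := Choice.on Q.
HB.instance Definition _ := EqQuotient.on Q.

Definition quot_pi (a : A) : Q := \pi_Q a.

Lemma quot_piP a b : quot_pi a = quot_pi b <-> ideal G (a - b).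
Proof.
by rewrite /quot_pi; split=> [/eqmodP /asboolP|Gab] //; apply/eqmodP/asboolP.
Qed.

Lemma quot_piK (u : Q) : quot_pi (repr u) = u.
Proof. exact: reprK. Qed.

Definition quot_add (u v : Q) := quot_pi (repr u + repr v).
Definition quot_opp (u : Q) := quot_pi (- repr u).
Definition quot_mul (u v : Q) := quot_pi (repr u * repr v).
Definition quot_scale (c : k) (u : Q) := quot_pi (c *: repr u).

Lemma repr_quot_pi a : ideal G (repr (quot_pi a) - a).
Proof. by apply/quot_piP; rewrite quot_piK. Qed.

Lemma quot_addE a b : quot_add (quot_pi a) (quot_pi b) = quot_pi (a + b).
Proof.
apply/quot_piP; rewrite opprD addrACA.
by apply: ideal_add; apply: repr_quot_pi.
Qed.

Lemma quot_oppE a : quot_opp (quot_pi a) = quot_pi (- a).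
Proof. by apply/quot_piP; rewrite -opprD; apply/ideal_opp/repr_quot_pi. Qed.

Lemma quot_mulE a b : quot_mul (quot_pi a) (quot_pi b) = quot_pi (a * b).
Proof.
apply/quot_piP; set a' := repr _; set b' := repr _.
have -> : a' * b' - a * b = (a' - a) * b' + a * (b' - b).
  by rewrite mulrBl mulrBr addrA subrK.
apply: ideal_add; first exact/ideal_mulr/repr_quot_pi.
exact/ideal_mull/repr_quot_pi.
Qed.

Lemma quot_scaleE c a : quot_scale c (quot_pi a) = quot_pi (c *: a).
Proof.
by apply/quot_piP; rewrite -scalerBr; apply/ideal_scale/repr_quot_pi.
Qed.

Lemma quot_ind (P : Q -> Prop) : (forall a, P (quot_pi a)) -> forall u, P u.
Proof. by move=> Ppi u; rewrite -(quot_piK u). Qed.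

Fact quot_addA : associative quot_add.
Proof.
elim/quot_ind=> a; elim/quot_ind=> b; elim/quot_ind=> c.
by rewrite !quot_addE addrA.
Qed.

Fact quot_addC : commutative quot_add.
Proof. by elim/quot_ind=> a; elim/quot_ind=> b; rewrite !quot_addE addrC. Qed.

Fact quot_add0 : left_id (quot_pi 0) quot_add.
Proof. by elim/quot_ind=> a; rewrite quot_addE add0r. Qed.

Fact quot_addN : left_inverse (quot_pi 0) quot_opp quot_add.
Proof. by elim/quot_ind=> a; rewrite quot_oppE quot_addE addNr. Qed.

HB.instance Definition _ :=
  GRing.isZmodule.Build Q quot_addA quot_addC quot_add0 quot_addN.

Lemma quot_piD a b : quot_pi (a + b) = quot_pi a + quot_pi b.
Proof. by rewrite -quot_addE. Qed.

Fact quot_mulA : associative quot_mul.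
Proof.
elim/quot_ind=> a; elim/quot_ind=> b; elim/quot_ind=> c.
by rewrite !quot_mulE mulrA.
Qed.

Fact quot_mul1l : left_id (quot_pi 1) quot_mul.
Proof. by elim/quot_ind=> a; rewrite quot_mulE mul1r. Qed.

Fact quot_mul1r : right_id (quot_pi 1) quot_mul.
Proof. by elim/quot_ind=> a; rewrite quot_mulE mulr1. Qed.

Fact quot_mulDl : left_distributive quot_mul +%R.
Proof.
elim/quot_ind=> a; elim/quot_ind=> b; elim/quot_ind=> c.
by rewrite -quot_piD !quot_mulE mulrDl quot_piD.
Qed.

Fact quot_mulDr : right_distributive quot_mul +%R.
Proof.
elim/quot_ind=> a; elim/quot_ind=> b; elim/quot_ind=> c.
by rewrite -quot_piD !quot_mulE mulrDr quot_piD.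
Qed.

Fact quot_oner_neq0 : quot_pi 1 != 0.
Proof. by apply/eqP => /quot_piP; rewrite subr0. Qed.

HB.instance Definition _ := GRing.Zmodule_isNzRing.Build Q
  quot_mulA quot_mul1l quot_mul1r quot_mulDl quot_mulDr quot_oner_neq0.

Fact quot_scaleA c d u : quot_scale c (quot_scale d u) = quot_scale (c * d) u.
Proof. by elim/quot_ind: u => a; rewrite !quot_scaleE scalerA. Qed.

Fact quot_scale1 : left_id 1 quot_scale.
Proof. by elim/quot_ind=> a; rewrite quot_scaleE scale1r. Qed.

Fact quot_scaleDr : right_distributive quot_scale +%R.
Proof.
move=> c; elim/quot_ind=> a; elim/quot_ind=> b.
by rewrite -quot_piD !quot_scaleE scalerDr quot_piD.
Qed.

Fact quot_scaleDl u : {morph quot_scale^~ u : c d / c + d}.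
Proof.
move=> c d; elim/quot_ind: u => a.
by rewrite !quot_scaleE scalerDl quot_piD.
Qed.

HB.instance Definition _ := GRing.Zmodule_isLmodule.Build k Q
  quot_scaleA quot_scale1 quot_scaleDr quot_scaleDl.

Lemma quot_piM a b : quot_pi (a * b) = quot_pi a * quot_pi b.
Proof. by rewrite -quot_mulE. Qed.

Lemma quot_piZ c a : quot_pi (c *: a) = c *: quot_pi a.
Proof. by rewrite -quot_scaleE. Qed.

Fact quot_scalerAl (c : k) (u v : Q) : c *: (u * v) = (c *: u) * v.
Proof.
elim/quot_ind: u => a; elim/quot_ind: v => b.
by rewrite -quot_piM -!quot_piZ -quot_piM scalerAl.
Qed.

Fact quot_scalerAr (c : k) (u v : Q) : c *: (u * v) = u * (c *: v).
Proof.
elim/quot_ind: u => a; elim/quot_ind: v => b.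
by rewrite -quot_piM -!quot_piZ -quot_piM scalerAr.
Qed.

HB.instance Definition _ :=
  GRing.Lmodule_isLalgebra.Build k Q quot_scalerAl.
HB.instance Definition _ :=
  GRing.Lalgebra_isAlgebra.Build k Q quot_scalerAr.

End Quotient.

Definition central_regular (B : nzRingType) (f : B) : Prop :=
  (forall b, f * b = b * f) /\ (forall b, f * b = 0 -> b = 0).

(* The localization B[f^-1] at a central regular element f; the pair (a, n)
   stands for the fraction a / f^n. *)
Section Localization.
Variables (k : fieldType) (B : algType k) (f : B).
Hypothesis fCR : central_regular f.

Let fC : forall b, f * b = b * f := fCR.1.
Let fR : forall b, f * b = 0 -> b = 0 := fCR.2.

Definition loc_rel : rel (B * nat) :=
  fun p q => f ^+ q.2 * p.1 == f ^+ p.2 * q.1.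

Lemma expf_comm n b : f ^+ n * b = b * f ^+ n.
Proof. exact/esym/commrX/esym/fC. Qed.

Lemma expf_reg n a b : f ^+ n * a = f ^+ n * b -> a = b.
Proof.
move/eqP; rewrite -subr_eq0 -mulrBr => /eqP fnab; apply/eqP; rewrite -subr_eq0.
elim: n fnab => [|n IHn]; first by rewrite mul1r => ->.
by rewrite exprS -mulrA => /fR/IHn.
Qed.

Lemma loc_rel_refl : reflexive loc_rel.
Proof. by move=> p; apply: eqxx. Qed.

Lemma loc_rel_sym : ssrbool.symmetric loc_rel.
Proof. by move=> p q; rewrite /loc_rel eq_sym. Qed.

Lemma loc_rel_trans : transitive loc_rel.
Proof.
move=> q p r /eqP pq /eqP qr; apply/eqP/(@expf_reg q.2).
rewrite mulrA -exprD addnC exprD -mulrA pq mulrA -exprD addnC exprD -mulrA qr.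
by rewrite !mulrA -!exprD addnC.
Qed.

Canonical loc_equiv := EquivRel loc_rel loc_rel_refl loc_rel_sym loc_rel_trans.

Definition loc := {eq_quot loc_equiv}.

HB.instance Definition _ := Choice.on loc.
HB.instance Definition _ := EqQuotient.on loc.

Definition loc_frac (a : B) (n : nat) : loc := \pi_loc (a, n).

Lemma loc_fracP a n b m :
  loc_frac a n = loc_frac b m <-> f ^+ m * a = f ^+ n * b.
Proof. by split=> [/eqmodP/eqP//|ab]; apply/eqmodP/eqP. Qed.

Lemma loc_fracK (u : loc) : loc_frac (repr u).1 (repr u).2 = u.
Proof. by rewrite /loc_frac -surjective_pairing; apply: reprK. Qed.

Lemma loc_ind (P : loc -> Prop) :
  (forall a n, P (loc_frac a n)) -> forall u, P u.
Proof. by move=> Pf u; rewrite -(loc_fracK u). Qed.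

Lemma loc_fracS p a n : loc_frac a n = loc_frac (f ^+ p * a) (p + n).
Proof. by apply/loc_fracP; rewrite mulrA -exprD addnC. Qed.

Lemma loc_frac_same a b n : loc_frac a n = loc_frac b n <-> a = b.
Proof. by split=> [/loc_fracP/expf_reg|->]. Qed.

Definition loc_add (u v : loc) :=
  loc_frac (f ^+ (repr v).2 * (repr u).1 + f ^+ (repr u).2 * (repr v).1)
           ((repr u).2 + (repr v).2).
Definition loc_opp (u : loc) := loc_frac (- (repr u).1) (repr u).2.
Definition loc_mul (u v : loc) :=
  loc_frac ((repr u).1 * (repr v).1) ((repr u).2 + (repr v).2).
Definition loc_scale (c : k) (u : loc) := loc_frac (c *: (repr u).1) (repr u).2.

Lemma repr_loc_frac a n :
  f ^+ n * (repr (loc_frac a n)).1 = f ^+ (repr (loc_frac a n)).2 * a.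
Proof. by apply/loc_fracP; rewrite loc_fracK. Qed.

Lemma loc_addE a b n :
  loc_add (loc_frac a n) (loc_frac b n) = loc_frac (a + b) n.
Proof.
rewrite /loc_add; have := repr_loc_frac a n; have := repr_loc_frac b n.
case: (repr (loc_frac a n)) (repr (loc_frac b n)) => [a' p] [b' q] /= eb ea.
apply/loc_fracP; rewrite !mulrDr !mulrA -!exprD.
rewrite (addnC n q) exprD -mulrA ea mulrA -exprD (addnC q p).
by rewrite (addnC n p) (exprD _ p n) -mulrA eb mulrA -exprD.
Qed.

Lemma loc_oppE a n : loc_opp (loc_frac a n) = loc_frac (- a) n.
Proof. by apply/loc_fracP; rewrite !mulrN repr_loc_frac. Qed.

Lemma loc_mulE a n b m :
  loc_mul (loc_frac a n) (loc_frac b m) = loc_frac (a * b) (n + m).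
Proof.
rewrite /loc_mul; have := repr_loc_frac a n; have := repr_loc_frac b m.
case: (repr (loc_frac a n)) (repr (loc_frac b m)) => [a' p] [b' q] /= eb ea.
have shuffle i j x y : f ^+ (i + j) * (x * y) = (f ^+ i * x) * (f ^+ j * y).
  by rewrite exprD -!mulrA [f ^+ j * (x * y)]mulrA (expf_comm j x) -mulrA.
by apply/loc_fracP; rewrite !shuffle ea eb.
Qed.

Lemma loc_scaleE c a n : loc_scale c (loc_frac a n) = loc_frac (c *: a) n.
Proof. by apply/loc_fracP; rewrite -!scalerAr repr_loc_frac. Qed.

Lemma loc_ind2 (P : loc -> loc -> Prop) :
  (forall a b n, P (loc_frac a n) (loc_frac b n)) -> forall u v, P u v.
Proof.
move=> Pf u v; elim/loc_ind: u => a n; elim/loc_ind: v => b m.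
by rewrite (loc_fracS m a) (loc_fracS n b) addnC.
Qed.

Lemma loc_ind3 (P : loc -> loc -> loc -> Prop) :
  (forall a b c n, P (loc_frac a n) (loc_frac b n) (loc_frac c n)) ->
  forall u v w, P u v w.
Proof.
move=> Pf u v w; move: u v; apply: loc_ind2 => a b n.
elim/loc_ind: w => c m.
by rewrite (loc_fracS m a) (loc_fracS m b) (loc_fracS n c) addnC.
Qed.

Fact loc_addA : associative loc_add.
Proof. by apply: loc_ind3 => a b c n; rewrite !loc_addE addrA. Qed.

Fact loc_addC : commutative loc_add.
Proof. by apply: loc_ind2 => a b n; rewrite !loc_addE addrC. Qed.

Fact loc_add0 : left_id (loc_frac 0 0) loc_add.
Proof.
by elim/loc_ind=> a n; rewrite (loc_fracS n 0) addn0 mulr0 loc_addE add0r.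
Qed.

Fact loc_addN : left_inverse (loc_frac 0 0) loc_opp loc_add.
Proof.
elim/loc_ind=> a n; rewrite loc_oppE loc_addE addNr.
by apply/loc_fracP; rewrite !mulr0.
Qed.

HB.instance Definition _ :=
  GRing.isZmodule.Build loc loc_addA loc_addC loc_add0 loc_addN.

Lemma loc_fracD a b n : loc_frac (a + b) n = loc_frac a n + loc_frac b n.
Proof. by rewrite -loc_addE. Qed.

Lemma loc_fracN a n : loc_frac (- a) n = - loc_frac a n.
Proof. by rewrite -loc_oppE. Qed.

Lemma loc_fracDE a n b m :
  loc_frac a n + loc_frac b m = loc_frac (f ^+ m * a + f ^+ n * b) (m + n).
Proof. by rewrite loc_fracD -loc_fracS addnC -loc_fracS. Qed.

Fact loc_mulA : associative loc_mul.
Proof. by apply: loc_ind3 => a b c n; rewrite !loc_mulE mulrA addnA. Qed.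

Fact loc_mul1l : left_id (loc_frac 1 0) loc_mul.
Proof. by elim/loc_ind=> a n; rewrite loc_mulE mul1r. Qed.

Fact loc_mul1r : right_id (loc_frac 1 0) loc_mul.
Proof. by elim/loc_ind=> a n; rewrite loc_mulE mulr1 addn0. Qed.

Fact loc_mulDl : left_distributive loc_mul +%R.
Proof.
by apply: loc_ind3 => a b c n; rewrite -loc_fracD !loc_mulE mulrDl loc_fracD.
Qed.

Fact loc_mulDr : right_distributive loc_mul +%R.
Proof.
by apply: loc_ind3 => a b c n; rewrite -loc_fracD !loc_mulE mulrDr loc_fracD.
Qed.

Fact loc_oner_neq0 : loc_frac 1 0 != 0.
Proof. by apply/eqP => /loc_frac_same/eqP; rewrite oner_eq0. Qed.

HB.instance Definition _ := GRing.Zmodule_isNzRing.Build loc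
  loc_mulA loc_mul1l loc_mul1r loc_mulDl loc_mulDr loc_oner_neq0.

Lemma loc_fracM a n b m :
  loc_frac (a * b) (n + m) = loc_frac a n * loc_frac b m.
Proof. by rewrite -loc_mulE. Qed.

Fact loc_scaleA c d u : loc_scale c (loc_scale d u) = loc_scale (c * d) u.
Proof. by elim/loc_ind: u => a n; rewrite !loc_scaleE scalerA. Qed.

Fact loc_scale1 : left_id 1 loc_scale.
Proof. by elim/loc_ind=> a n; rewrite loc_scaleE scale1r. Qed.

Fact loc_scaleDr : right_distributive loc_scale +%R.
Proof.
move=> c; apply: loc_ind2 => a b n.
by rewrite -loc_fracD !loc_scaleE scalerDr loc_fracD.
Qed.

Fact loc_scaleDl u : {morph loc_scale^~ u : c d / c + d}.
Proof.
move=> c d; elim/loc_ind: u => a n.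
by rewrite !loc_scaleE scalerDl loc_fracD.
Qed.

HB.instance Definition _ := GRing.Zmodule_isLmodule.Build k loc
  loc_scaleA loc_scale1 loc_scaleDr loc_scaleDl.

Lemma loc_fracZ c a n : loc_frac (c *: a) n = c *: loc_frac a n.
Proof. by rewrite -loc_scaleE. Qed.

Fact loc_scalerAl (c : k) (u v : loc) : c *: (u * v) = (c *: u) * v.
Proof.
move: u v; apply: loc_ind2 => a b n.
by rewrite -loc_fracM -!loc_fracZ -loc_fracM scalerAl.
Qed.

Fact loc_scalerAr (c : k) (u v : loc) : c *: (u * v) = u * (c *: v).
Proof.
move: u v; apply: loc_ind2 => a b n.
by rewrite -loc_fracM -!loc_fracZ -loc_fracM scalerAr.
Qed.

HB.instance Definition _ :=
  GRing.Lmodule_isLalgebra.Build k loc loc_scalerAl.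
HB.instance Definition _ :=
  GRing.Lalgebra_isAlgebra.Build k loc loc_scalerAr.

End Localization.

(* The free algebra k<x_0, ..., x_(n-1)>, that is T(V) for V = k^n with its
   standard basis. The dual basis identifies the tensor algebra of the dual of V
   with the same algebra; the dual basis elements are again written x_i. *)
Definition freeAlg (k : fieldType) (n : nat) := {malg k[{fmonom 'I_n}]}.

Section FreeAlgebra.
Variables (k : fieldType) (n : nat).
Local Notation T := (freeAlg k n).

HB.instance Definition _ := GRing.Lalgebra.on T.

Fact malg_scalerAr (c : k) (a b : {malg k[{fmonom 'I_n}]}) :
  c *: (a * b) = a * (c *: b).
Proof.
rewrite !malgM_def [fgmul a (c *: b)](fgmulrw (fsubset_refl _) (msuppZ_le c b)).
rewrite fgmulr scaler_sumr; apply: eq_bigr => m2 _.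
rewrite scaler_sumr; apply: eq_bigr => m1 _.
apply/malgP => m; rewrite mcoeffZ [X in c * X]mcoeffU [RHS]mcoeffU.
by rewrite mcoeffZ mulrCA mulrnAr.
Qed.

Fact free_scalerAr (c : k) (a b : T) : c *: (a * b) = a * (c *: b).
Proof. exact: malg_scalerAr. Qed.

HB.instance Definition _ := GRing.Lalgebra_isAlgebra.Build k T free_scalerAr.

Definition free_gen (i : 'I_n) : T := << fmu i >>.

Definition free_homog (d : nat) (t : T) : Prop :=
  forall m : {fmonom 'I_n}, mcoeff m t != 0 -> size m = d.

(* the coefficient of x_i x_j *)
Definition coef2 (t : T) (i j : 'I_n) : k := mcoeff (mmul (fmu i) (fmu j)) t.

Lemma free_homog1 : free_homog 0 1.
Proof.
move=> m; rewrite mcoeff1; case: (m =P _) => [-> _|_]; last by rewrite eqxx.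
by rewrite fm1.
Qed.

Lemma free_homogD d s t : free_homog d s -> free_homog d t -> free_homog d (s + t).
Proof.
move=> hs ht m; rewrite mcoeffD; have [/eqP s0|/hs//] := boolP (mcoeff m s == 0).
by rewrite s0 add0r => /ht.
Qed.

Lemma free_homogZ d c t : free_homog d t -> free_homog d (c *: t).
Proof. by move=> ht m; rewrite mcoeffZ mulf_eq0 negb_or => /andP[_ /ht]. Qed.

Lemma free_homogM d e s t :
  free_homog d s -> free_homog e t -> free_homog (d + e) (s * t).
Proof.
move=> hs ht m; rewrite mcoeff_neq0 => /msuppM_le[m1 [m2 []]].
rewrite -!mcoeff_neq0 => /hs <- /ht <- ->.
by rewrite fmM size_cat.
Qed.

Lemma free_homog_mcoeff1 d t : (0 < d)%N -> free_homog d t ->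
  mcoeff (mone : {fmonom 'I_n}) t = 0.
Proof.
move=> d0 ht; apply/eqP; apply: contraTT d0 => /ht <-.
by rewrite fm1.
Qed.

End FreeAlgebra.

(* A quadratic algebra T(V)/(R) is given by a list s of elements of degree 2
   spanning R; [perp s] is the orthogonal complement of R. *)
Section QuadraticDual.
Variables (k : fieldType) (n : nat).

Definition perp (s : seq (freeAlg k n)) (t : freeAlg k n) : Prop :=
  free_homog 2 t /\
  forall r, r \in s -> \sum_(i < n) \sum_(j < n) coef2 t i j * coef2 r i j = 0.

Variable s : seq (freeAlg k n).

Fact perp_proper : ~ ideal (perp s) 1.
Proof.
pose e : {rmorphism {malg k[{fmonom 'I_n}]} -> k} :=
  @mcoeff {fmonom 'I_n} k mone.
apply: (@ideal_proper k (freeAlg k n) _ k e) => t [ht _].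
exact: free_homog_mcoeff1 ht.
Qed.

Definition qdual : algType k := quot perp_proper.

Definition qdual_pi (t : freeAlg k n) : qdual := quot_pi perp_proper t.

Definition qdual_gen (i : 'I_n) : qdual := qdual_pi (free_gen k i).

Definition qdual_homog (d : nat) (a : qdual) : Prop :=
  exists2 t, free_homog d t & a = qdual_pi t.

Lemma qdual_homog1 : qdual_homog 0 1.
Proof. by exists 1 => //; apply: free_homog1. Qed.

Lemma qdual_homogD d a b :
  qdual_homog d a -> qdual_homog d b -> qdual_homog d (a + b).
Proof.
move=> [t ht ->] [u hu ->]; exists (t + u); first exact: free_homogD.
by rewrite /qdual_pi quot_piD.
Qed.

Lemma qdual_homogZ d c a : qdual_homog d a -> qdual_homog d (c *: a).
Proof.
move=> [t ht ->]; exists (c *: t); first exact: free_homogZ.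
by rewrite /qdual_pi quot_piZ.
Qed.

Lemma qdual_homogM d e a b :
  qdual_homog d a -> qdual_homog e b -> qdual_homog (d + e) (a * b).
Proof.
move=> [t ht ->] [u hu ->]; exists (t * u); first exact: free_homogM.
by rewrite /qdual_pi quot_piM.
Qed.

Lemma qdual_homogX d n' a : qdual_homog d a -> qdual_homog (n' * d) (a ^+ n').
Proof.
move=> ha; elim: n' => [|m IHm]; first exact: qdual_homog1.
by rewrite exprS mulSn; apply: qdual_homogM.
Qed.

End QuadraticDual.

(* The conic A = S/(f), where S has relations s, has relations f :: s. *)
Section Conic.
Variables (k : fieldType) (n : nat) (s : seq (freeAlg k n)) (f : freeAlg k n).
Local Notation A_dual := (qdual (f :: s)).

(* fd is f^!; the last clause says A^!/(f^!) = S^! as quotients of the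
   free algebra. *)
Record is_dual_elt (fd : A_dual) : Prop := IsDualElt {
  dual_elt_homog : qdual_homog 2 fd;
  dual_elt_reg : central_regular fd;
  dual_elt_quot : forall t : freeAlg k n,
    qdual_pi s t = 0 <-> ideal (fun a => a = fd) (qdual_pi (f :: s) t)
}.

End Conic.

Arguments is_dual_elt {k n} s f fd.

Section DegreeZero.
Variables (k : fieldType) (n : nat) (s : seq (freeAlg k n)) (f : freeAlg k n).
Local Notation A_dual := (qdual (f :: s)).

Variables (fd : A_dual) (fdP : is_dual_elt s f fd).

Definition qdual_loc : algType k := loc (dual_elt_reg fdP).

Definition qdual_frac (a : A_dual) (m : nat) : qdual_loc :=
  loc_frac (dual_elt_reg fdP) a m.

Definition loc_deg0 : {pred qdual_loc} := fun u =>
  `[< exists a m, qdual_homog (m * 2) a /\ u = qdual_frac a m >].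

Lemma loc_deg0P u :
  reflect (exists a m, qdual_homog (m * 2) a /\ u = qdual_frac a m)
          (u \in loc_deg0).
Proof. exact: asboolP. Qed.

Fact loc_deg0_subalg_closed : subalg_closed loc_deg0.
Proof.
split.
- by apply/loc_deg0P; exists 1, 0%N; split=> //; apply: qdual_homog1.
- move=> c u v /loc_deg0P[a [p [ha ->]]] /loc_deg0P[b [q [hb ->]]].
  apply/loc_deg0P; exists (fd ^+ q * (c *: a) + fd ^+ p * b), (q + p)%N; split.
    apply: qdual_homogD; [|rewrite addnC]; rewrite mulnDl; apply: qdual_homogM.
    + exact/qdual_homogX/dual_elt_homog.
    + exact: qdual_homogZ.
    + exact/qdual_homogX/dual_elt_homog.
    + exact: hb.
  by rewrite /qdual_frac -loc_fracZ loc_fracDE.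
- move=> u v /loc_deg0P[a [p [ha ->]]] /loc_deg0P[b [q [hb ->]]].
  apply/loc_deg0P; exists (a * b), (p + q)%N; split.
    by rewrite mulnDl; apply: qdual_homogM.
  by rewrite /qdual_frac loc_fracM.
Qed.

HB.instance Definition _ :=
  GRing.isSubalgClosed.Build k qdual_loc loc_deg0 loc_deg0_subalg_closed.

(* C(A) = A^![(f^!)^-1]_0 *)
Definition C_alg := {u : qdual_loc | u \in loc_deg0}.

HB.instance Definition _ := SubChoice.on C_alg.
HB.instance Definition _ := [SubChoice_isSubAlgebra of C_alg by <:].

End DegreeZero.

From mathcomp.multinomials Require Import mpoly.

(* [mpoly n k] is k[x_0, ..., x_(n-1)]; its usual notation is shadowed by
   the one of monalg. *)

Section Presentations.
Variables (k : fieldType) (n : nat).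

(* A^! = k[x_0, ..., x_(n-1)]/(q), compatibly with the names of generators *)
Definition qdual_is (s : seq (freeAlg k n)) (q : seq (mpoly n k)) : Prop :=
  exists (q_proper : ~ ideal (fun p => p \in q) 1)
         (phi : {lrmorphism qdual s -> quot q_proper}),
    bijective phi /\
    forall i, phi (qdual_gen s i) = quot_pi q_proper 'X_i.

(* C(S/(f)) is isomorphic to B. It depends on a choice of f^!, so existence of
   f^! is asserted and the isomorphism is claimed for every choice. *)
Definition C_is (s : seq (freeAlg k n)) (f : freeAlg k n) (B : algType k) :
    Prop :=
  (exists fd, is_dual_elt s f fd) /\
  forall fd (fdP : is_dual_elt s f fd), alg_iso (C_alg fdP) B.

Definition conic_is (s : seq (freeAlg k n)) (f : freeAlg k n)
    (q : seq (mpoly n k)) (B : algType k) : Prop :=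
  qdual_is (f :: s) q /\ C_is s f B.

End Presentations.

Section Models.
Variable k : fieldType.

(* k[u]/(u^m), for 0 < m *)
Definition trunc (m : nat) : algType k := {poly %/ ('X^m : {poly k})}.

Definition uv_squares : seq (mpoly 2 k) := [:: 'X_ord0 ^+ 2; 'X_ord_max ^+ 2].

Fact uv_squares_proper : ~ ideal (fun p => p \in uv_squares) 1.
Proof.
pose e : {rmorphism mpoly 2 k -> k} := meval (fun=> 0 : k).
apply: (ideal_proper (e := e)) => g; rewrite !inE => /orP[]/eqP->.
- by rewrite rmorphXn /= mevalXU expr2 mulr0.
- by rewrite rmorphXn /= mevalXU expr2 mulr0.
Qed.

(* k[u,v]/(u^2, v^2) *)
Definition trunc_uv : algType k := quot uv_squares_proper.

Definition k2 : algType k := (k^o * k^o)%type.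
Definition k4 : algType k := (k^o * k^o * k^o * k^o)%type.

End Models.

Definition i0 : 'I_3 := @Ordinal 3 0 isT.
Definition i1 : 'I_3 := @Ordinal 3 1 isT.
Definition i2 : 'I_3 := @Ordinal 3 2 isT.

Section ThreeVariables.
Variable k : fieldType.

Definition fx : freeAlg k 3 := free_gen k i0.
Definition fy : freeAlg k 3 := free_gen k i1.
Definition fz : freeAlg k 3 := free_gen k i2.

Definition px : mpoly 3 k := 'X_i0.
Definition py : mpoly 3 k := 'X_i1.
Definition pz : mpoly 3 k := 'X_i2.

Local Notation x := fx.
Local Notation y := fy.
Local Notation z := fz.

Definition rel_S : seq (freeAlg k 3) :=
  [:: x * y + y * x; y * z + z * y; z * x + x * z].

Definition rel_S' : seq (freeAlg k 3) :=
  [:: x * y + y * x; y * z + z * y + x ^+ 2; z * x + x * z].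

Definition rel_N : seq (freeAlg k 3) :=
  [:: x * y + y * x; y * z + z * y + x ^+ 2; z * x + x * z + y ^+ 2].

End ThreeVariables.

(* MathComp's Sylvester matrix lists coefficients in increasing degree. This
   changes the resultant of p and p' by the sign (-1)^(d(d-1)) = 1. *)
Definition discriminant (k : fieldType) (p : {poly k}) : k :=
  let d := (size p).-1 in
  (-1) ^+ 'C(d, 2) * resultant p p^`() / lead_coef p.

Definition quartic (k : fieldType) (alpha beta : k) : {poly k} :=
  'X^4 - (2 * beta) *: 'X^2 - 'X + (beta ^+ 2 - alpha)%:P.

Definition Delta (k : fieldType) (alpha beta : k) : k :=
  discriminant (quartic alpha beta).

(* Main.v *)
Require Import Defs.
From HB Require Import structures.
From mathcomp Require Import all_boot all_order all_algebra.
From mathcomp Require Import separable.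
From mathcomp Require boolp.
From mathcomp Require Import finmap.
From mathcomp.multinomials Require Import monalg.
From mathcomp.multinomials Require Import mpoly.
From mathcomp Require Import ring.

Set Implicit Arguments.
Unset Strict Implicit.
Unset Printing Implicit Defensive.

Import GRing.Theory.
Local Open Scope ring_scope.

(** The relations of S and the form f are symmetric tensors, so the dual A^! of
    A = S/(f) contains the commutators: it is the homogeneous coordinate ring
    k[x,y,z]/(q1,q2) of the intersection of two conics, and C(A) is the ring of
    functions on this scheme of length four.

    In every case one of the variables, called w below, vanishes at no point of
    the scheme, and with the other two variables u, v the relations take the
    form u^2 = a w^2 + b wu + c wv + d uv and v^2 = a' w^2 + b' wu + c' wv.
    They show that A^! is spanned over k[w] by 1, u, v, uv. Let B be a
    commutative algebra with elements U, V that satisfy the relations at w = 1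
    and such that 1, U, V, UV is a basis of B. For each scalar l there is an
    evaluation A^! -> B with w, u, v |-> l, lU, lV. An element killed by all of
    them is zero, because k is infinite and its four coefficients in k[w] vanish
    at every l ([spanned_eval_inj]). This one fact gives three things. The
    surjection from A^! to k[x,y,z]/(q1,q2) is injective, since the evaluations
    factor through it ([quadratic_dual_is]). An element of degree two whose
    value in B is a unit is regular, which yields f^!. Finally, for any choice
    of f^!, the evaluation at l = 1 is injective on each graded piece and maps
    the piece of degree two onto B; thus f^! acts injectively on B, its value is
    a unit, and a / (f^!)^n |-> ev(a) ev(f^!)^-n is an isomorphism from C(A) to B
    ([C_is_model]). The uniqueness of f^! is not needed.

    What remains is to solve the relations in the listed algebra B. The three
    quantum algebras have relations xy + yx, yz + zy + e1 x^2, zx + xz + e2 y^2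
    with e1, e2 in {0, 1}, and f = a x^2 + b y^2 + c z^2, so only three families
    occur, according to the last nonzero coefficient of f. In the family with
    c = 1 and e1 = e2 = 1 the relations are U^2 = V + a and V^2 = U + b: V is a
    root of the quartic t^4 - 2b t^2 - t - a + b^2 and U = V^2 - b. The
    discriminant is the resultant of the quartic and its derivative. It vanishes
    exactly when there is a multiple root; the coefficients of t^3 and t exclude
    two double roots and a quadruple root, and a triple root forces
    a = 3 mu / 4, b = 3 mu^2 / 4 with mu^3 = 1. *)

(** * Morphisms, quotients and tensors of degree two *)

Lemma lrmorphism_of (k : fieldType) (A B : algType k) (f : A -> B) :
  (forall c a b, f (c *: a + b) = c *: f a + f b) -> f 1 = 1 ->
  (forall a b, f (a * b) = f a * f b) ->
  exists g : {lrmorphism A -> B}, g =1 f.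
Proof.
move=> fL f1 fM.
pose fl := GRing.isLinear.Build k A B *:%R f fL.
pose fm := GRing.isMonoidMorphism.Build A B f (conj f1 fM).
pose g : {lrmorphism A -> B} := HB.pack f fl fm.
by exists g.
Qed.

Section LRMorphismTheory.
Variables (k : fieldType) (A B : algType k) (f : {lrmorphism A -> B}).

Lemma lrmorph0 : f 0 = 0. Proof. exact: rmorph0. Qed.

Lemma lrmorph1 : f 1 = 1. Proof. exact: rmorph1. Qed.

Lemma lrmorphD a b : f (a + b) = f a + f b. Proof. exact: rmorphD. Qed.

Lemma lrmorphB a b : f (a - b) = f a - f b. Proof. exact: rmorphB. Qed.

Lemma lrmorphM a b : f (a * b) = f a * f b. Proof. exact: rmorphM. Qed.

Lemma lrmorphZ c a : f (c *: a) = c *: f a. Proof. exact: linearZZ. Qed.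

Lemma lrmorph_sum (I : Type) (r : seq I) (F : I -> A) :
  f (\sum_(i <- r) F i) = \sum_(i <- r) f (F i).
Proof. exact: raddf_sum. Qed.

End LRMorphismTheory.

Lemma quot_hom (k : fieldType) (A B : algType k) (G : A -> Prop)
    (proper : ~ ideal G 1) (phi : {lrmorphism A -> B}) :
  (forall g, G g -> phi g = 0) ->
  exists psi : {lrmorphism quot proper -> B},
    forall a, psi (quot_pi proper a) = phi a.
Proof.
move=> phiG; pose f (x : quot proper) := phi (generic_quotient.repr x).
have fE a : f (quot_pi proper a) = phi a.
  apply/eqP; rewrite -subr_eq0 -rmorphB; apply/eqP.
  by apply: (ideal_ker phiG); apply: repr_quot_pi.
have [|||g gE] := @lrmorphism_of k (quot proper) B f.
- move=> c; elim/quot_ind=> a; elim/quot_ind=> b.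
  by rewrite -quot_piZ -quot_piD !fE linearP.
- by rewrite -[1]/(quot_pi proper 1) fE rmorph1.
- by elim/quot_ind=> a; elim/quot_ind=> b; rewrite -quot_piM !fE rmorphM.
by exists g => a; rewrite gE fE.
Qed.

(* The free algebra is a monoid algebra: in this section mcoeff, msupp and
   their lemmas are those of monoid algebras, not of polynomials. *)
Section FreeAlgebra.
Import monalg.
Variables (k : fieldType) (n : nat).
Local Notation T := (freeAlg k n).
Local Notation x := (@free_gen k n).
Local Notation M := (monalg.fmonom 'I_n).

(** The word m as an element of the free algebra. *)
Definition word (m : M) : T := mkmalgU m 1.

Lemma word_nil : word (FMonom [::]) = 1.
Proof. by rewrite /word -fmoneE. Qed.

Lemma word_cons i m : word (FMonom (i :: m)) = x i * word (FMonom m).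
Proof.
rewrite /word /free_gen malgM_def fgmulUU mulr1.
congr mkmalgU; rewrite fmuE.
exact: (esym (fmmulE (FMonom [:: i]) (FMonom m))).
Qed.

Lemma free_wordE (t : T) : t = \sum_(m <- msupp t) mcoeff m t *: word m.
Proof.
rewrite [LHS]monalgE; apply: eq_bigr => m _.
by apply/malgP => m'; rewrite mcoeffZ !mcoeffU mulr_natr.
Qed.

Lemma free_ind (P : T -> Prop) :
  P 1 -> (forall s t, P s -> P t -> P (s + t)) ->
  (forall c t, P t -> P (c *: t)) -> (forall i t, P t -> P (x i * t)) ->
  forall t, P t.
Proof.
move=> P1 PD PZ PX t.
have P0 : P 0 by rewrite -(scale0r 1); apply: PZ.
have PM m : P (word m).
  case: m; elim=> [|i m IHm]; first by rewrite word_nil.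
  by rewrite word_cons; apply: PX.
by rewrite (free_wordE t); apply: (big_ind P) => // m _; apply: PZ.
Qed.
Section Hom.
Variables (B : algType k) (h : 'I_n -> B).

Definition word_eval (m : M) : B := \prod_(i <- fmonom_val m) h i.

Fact word_eval_morph : monalg.mmorphism word_eval.
Proof.
split=> [a b|]; rewrite /word_eval; last by rewrite fm1 big_nil.
by rewrite fmM big_cat.
Qed.

HB.instance Definition _ := monalg.isMultiplicative.Build M B word_eval
  word_eval_morph.

(** The universal property of the free algebra. *)
Lemma free_hom : exists phi : {lrmorphism T -> B}, forall i, phi (x i) = h i.
Proof.
pose f : T -> B := monalg.mmap (in_alg B) word_eval.
have fC : multiplicative f.
  apply: monalg.commr_mmap_is_multiplicative => g m m'.
  by rewrite /GRing.comm /= mulr_algl mulr_algr.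
have [c a b||a b|g gE] := @lrmorphism_of k T B f.
- by rewrite /f raddfD /= monalg.mmapZ /= mulr_algl.
- exact: monalg.mmap1.
- exact: fC.1.
exists g => i; rewrite gE /f /free_gen monalg.mmapU /= scale1r mul1r.
by rewrite /word_eval fmU big_seq1.
Qed.

End Hom.

Implicit Types s t r : T.

Lemma coef2D s t i j : coef2 (s + t) i j = coef2 s i j + coef2 t i j.
Proof. exact: monalg.mcoeffD. Qed.

Lemma coef2Z c t i j : coef2 (c *: t) i j = c * coef2 t i j.
Proof. exact: monalg.mcoeffZ. Qed.

Lemma coef2N t i j : coef2 (- t) i j = - coef2 t i j.
Proof. by rewrite -scaleN1r coef2Z mulN1r. Qed.

Lemma coef2_0 i j : coef2 (0 : T) i j = 0.
Proof. exact: monalg.mcoeff0. Qed.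

Lemma coef2_sum (I : finType) (F : I -> T) i j :
  coef2 (\sum_l F l) i j = \sum_l coef2 (F l) i j.
Proof.
apply: (big_morph (fun t : T => coef2 t i j)) => [s t|].
  exact: coef2D.
exact: coef2_0.
Qed.

(** The monomial x_i x_j. It is locked, which keeps unification from unfolding
    the product of the free algebra. *)
Definition gen2 : 'I_n -> 'I_n -> T := locked (fun i j => x i * x j).

Lemma gen2E : gen2 = fun i j => x i * x j.
Proof. by rewrite /gen2 -lock. Qed.

Lemma coef2M a b i j : coef2 (gen2 a b) i j = ((i == a) && (j == b))%:R.
Proof.
rewrite gen2E /coef2 /free_gen malgM_def fgmulUU mulr1 mcoeffU.
congr (nat_of_bool _)%:R.
rewrite fmP !fmM !fmU /= eqseq_cons [a == i]eq_sym; congr (_ && _).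
by rewrite eqseq_cons andbT eq_sym.
Qed.

Lemma homog_gen i : free_homog 1 (x i).
Proof.
by move=> m; rewrite mcoeffU; case: (fmu i =P m) => [<- _|_ /eqP//]; rewrite fmU.
Qed.

Lemma homog_genM i j : free_homog 2 (gen2 i j).
Proof. rewrite gen2E; exact: (@free_homogM _ _ 1 1 _ _ (@homog_gen i) (@homog_gen j)). Qed.

Lemma free_homog0 d : free_homog d (0 : T).
Proof. by move=> m; rewrite mcoeff0 eqxx. Qed.

Lemma free_homogN d t : free_homog d t -> free_homog d (- t).
Proof. by move=> ht; rewrite -scaleN1r; apply: free_homogZ. Qed.

Lemma homog2_eq0 t :
  free_homog 2 t -> (forall i j, coef2 t i j = 0) -> t = 0.
Proof.
move=> ht t0; apply/malgP => m; rewrite mcoeff0; apply/eqP.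
apply: contra_eqT (erefl 0 : 0 = 0 :> k) => tm.
have := ht m tm; case E: m => [l] /= sl.
case: l sl E => [|a [|b []]] //= _ E; move: tm.
suff mE : m = mmul (fmu a) (fmu b).
  by rewrite mE; apply: contraNT => _; apply/eqP; apply: t0.
by apply/eqP; rewrite fmP fmM !fmU E.
Qed.

Lemma coef2_quadratic (F : 'I_n -> 'I_n -> k) a b :
  coef2 (\sum_i \sum_j F i j *: gen2 i j) a b = F a b.
Proof.
rewrite coef2_sum.
transitivity (\sum_i \sum_j F i j * ((a == i) && (b == j))%:R).
  apply: eq_bigr => i _; rewrite coef2_sum; apply: eq_bigr => j _.
  by rewrite coef2Z coef2M.
rewrite (bigD1 a) //= [X in _ + X]big1 => [|i ia]; last first.
  by rewrite big1 // => j _; rewrite eq_sym (negPf ia) mulr0.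
rewrite addr0 (bigD1 b) //= big1 => [|j jb].
  by rewrite !eqxx mulr1 addr0.
by rewrite [b == j]eq_sym (negPf jb) andbF mulr0.
Qed.

Lemma homog_sumE t : free_homog 2 t ->
  t = \sum_i \sum_j coef2 t i j *: gen2 i j.
Proof.
move=> ht; apply/eqP; rewrite -subr_eq0; apply/eqP/homog2_eq0.
  apply: free_homogD => //; apply/free_homogN.
  apply: (big_ind (@free_homog k n 2)) => [||i _]; first exact: free_homog0.
    exact: free_homogD.
  apply: (big_ind (@free_homog k n 2)) => [||j _]; first exact: free_homog0.
    exact: free_homogD.
  exact/free_homogZ/homog_genM.
move=> a b; rewrite coef2D coef2N coef2_quadratic.
exact: subrr.
Qed.

(** The pairing between tensors of degree two for which [perp] is the
    orthogonal complement. *)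
Definition pairing t r : k := \sum_i \sum_j coef2 t i j * coef2 r i j.

Lemma pairingDr t r s : pairing t (r + s) = pairing t r + pairing t s.
Proof.
rewrite /pairing -big_split; apply: eq_bigr => i _ /=.
by rewrite -big_split; apply: eq_bigr => j _ /=; rewrite coef2D mulrDr.
Qed.

Lemma pairingC t r : pairing t r = pairing r t.
Proof. by apply: eq_bigr => i _; apply: eq_bigr => j _; rewrite mulrC. Qed.

Lemma pairingDl t r s : pairing (r + s) t = pairing r t + pairing s t.
Proof. by rewrite pairingC pairingDr ![pairing t _]pairingC. Qed.

Lemma pairingZr c t r : pairing t (c *: r) = c * pairing t r.
Proof.
rewrite /pairing big_distrr; apply: eq_bigr => i _ /=.
by rewrite big_distrr; apply: eq_bigr => j _ /=; rewrite coef2Z mulrCA.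
Qed.

Lemma pairingZl c t r : pairing (c *: t) r = c * pairing t r.
Proof. by rewrite pairingC pairingZr pairingC. Qed.

Lemma pairingNl t r : pairing (- t) r = - pairing t r.
Proof. by rewrite -scaleN1r pairingZl mulN1r. Qed.

Lemma pairing_gen t a b : pairing t (gen2 a b) = coef2 t a b.
Proof.
rewrite /pairing (bigD1 a) //= [X in _ + X]big1 => [|i ia]; last first.
  by rewrite big1 // => j _; rewrite coef2M (negPf ia) mulr0.
rewrite addr0 (bigD1 b) //= big1 => [|j jb].
  by rewrite coef2M !eqxx mulr1 addr0.
by rewrite coef2M (negPf jb) andbF mulr0.
Qed.

Lemma pairing_genl t a b : pairing (gen2 a b) t = coef2 t a b.
Proof. by rewrite pairingC pairing_gen. Qed.

(** The degree-two part of r is a symmetric tensor. *)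
Definition symmetric2 r := forall i j, coef2 r i j = coef2 r j i.

Lemma symmetric2D r s :
  symmetric2 r -> symmetric2 s -> symmetric2 (r + s).
Proof. by move=> hr hs i j; rewrite !coef2D hr hs. Qed.

Lemma symmetric2Z c r : symmetric2 r -> symmetric2 (c *: r).
Proof. by move=> hr i j; rewrite !coef2Z hr. Qed.

Lemma symmetric2X a : symmetric2 (gen2 a a).
Proof. by move=> i j; rewrite !coef2M andbC. Qed.

Lemma symmetric2C a b : symmetric2 (gen2 a b + gen2 b a).
Proof.
move=> i j; rewrite !coef2D !coef2M addrC.
by congr (_ + _); congr (nat_of_bool _)%:R; apply: andbC.
Qed.

End FreeAlgebra.

Section Dual.
Import monalg.
Variables (k : fieldType) (n : nat) (s : seq (freeAlg k n)).
Local Notation x := (@free_gen k n).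

Lemma qdual_pi_eq0 t : perp s t -> qdual_pi s t = 0.
Proof. by move=> st; apply/quot_piP; rewrite subr0; apply: ideal_gen. Qed.

Lemma qdual_ind (P : qdual s -> Prop) :
  P 1 -> (forall a b, P a -> P b -> P (a + b)) ->
  (forall c a, P a -> P (c *: a)) ->
  (forall i a, P a -> P (qdual_gen s i * a)) -> forall a, P a.
Proof.
move=> P1 PD PZ PX; elim/quot_ind => t.
elim/free_ind: t => [|a b Pa Pb|c a Pa|i a Pa].
- exact: P1.
- by rewrite quot_piD; apply: PD.
- by rewrite quot_piZ; apply: PZ.
- by rewrite quot_piM; apply: PX.
Qed.

Lemma qdual_gen2 i j :
  qdual_pi s (gen2 k i j) = qdual_gen s i * qdual_gen s j.
Proof. by rewrite gen2E; apply: quot_piM. Qed.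

(** Symmetric relations are orthogonal to the commutators x_i x_j - x_j x_i,
    which are therefore relations of the dual. *)
Lemma qdual_mulC : (forall r, r \in s -> symmetric2 r) ->
  forall a b : qdual s, a * b = b * a.
Proof.
move=> sS.
have genC i j : qdual_gen s i * qdual_gen s j = qdual_gen s j * qdual_gen s i.
  apply/eqP; rewrite -subr_eq0; apply/eqP.
  have /qdual_pi_eq0 : perp s (gen2 k i j + (-1) *: gen2 k j i).
    split; first exact/free_homogD/free_homogZ/homog_genM/homog_genM.
    move=> r rs; rewrite -/(pairing _ _) pairingDl pairingZl.
    by rewrite !pairing_genl (sS r rs i j) mulN1r subrr.
  by rewrite /qdual_pi quot_piD quot_piZ scaleN1r ![quot_pi _ _]qdual_gen2.
suff comm_gen i b : GRing.comm b (qdual_gen s i).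
  move=> a b; apply: commr_sym.
  elim/qdual_ind: a => [|a1 a2 h1 h2|c a ha|i a ha].
  - exact: commr1.
  - exact: commrD.
  - by rewrite /GRing.comm -scalerAl -scalerAr ha.
  - by apply: commrM ha; apply: comm_gen.
apply: commr_sym.
elim/qdual_ind: b => [|b1 b2 h1 h2|c b hb|j b hb].
- exact: commr1.
- exact: commrD.
- by rewrite /GRing.comm -scalerAl -scalerAr hb.
- by apply: commrM hb; apply: genC.
Qed.

Lemma qdual_hom (B : algType k) (h : 'I_n -> B) :
  (forall t, perp s t -> \sum_i \sum_j coef2 t i j *: (h i * h j) = 0) ->
  exists phi : {lrmorphism qdual s -> B}, forall i, phi (qdual_gen s i) = h i.
Proof.
move=> hs; have [phi phiE] := free_hom h.
have [|psi psiE] := quot_hom (@perp_proper k n s) (phi := phi).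
  move=> t st; rewrite (homog_sumE st.1) -[RHS](hs t st) lrmorph_sum.
  apply: eq_bigr => i _; rewrite lrmorph_sum; apply: eq_bigr => j _.
  by rewrite lrmorphZ gen2E lrmorphM !phiE.
by exists psi => i; rewrite /qdual_gen /qdual_pi psiE.
Qed.

(** If f is c times g on the generators, then f is c^d times g in degree d. *)
Lemma qdual_homog_eval (B : algType k) (f : {lrmorphism qdual s -> B})
    (g : {lrmorphism qdual s -> B}) (c : k) :
  (forall i, f (qdual_gen s i) = c *: g (qdual_gen s i)) ->
  forall d a, qdual_homog d a -> f a = c ^+ d *: g a.
Proof.
move=> fg d _ [t ht ->].
have fgm m : f (qdual_pi s (word k m)) =
             c ^+ size m *: g (qdual_pi s (word k m)).
  case: m; elim=> [|i m IHm].
    by rewrite word_nil [qdual_pi s 1]/(1 : qdual s) !lrmorph1 scale1r.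
  rewrite word_cons /qdual_pi quot_piM !lrmorphM IHm.
  by rewrite [f _]fg /= -scalerAl -scalerAr scalerA -exprS.
have piS (r : seq (fmonom 'I_n)) (F : fmonom 'I_n -> freeAlg k n) :
    qdual_pi s (\sum_(m <- r) F m) = \sum_(m <- r) qdual_pi s (F m).
  by apply: (big_morph (qdual_pi s)) => // a b; apply: quot_piD.
rewrite (free_wordE t) piS !lrmorph_sum scaler_sumr big_seq [RHS]big_seq.
apply: eq_bigr => m; rewrite -mcoeff_neq0 => /ht md.
by rewrite /qdual_pi quot_piZ !lrmorphZ [f _]fgm md !scalerA mulrC.
Qed.

End Dual.

(** * Finite-dimensional algebras and polynomial rings *)

Section Basis.
Variables (k : fieldType) (n : nat).

(** The family e is linearly independent. *)
Definition lin_free (B : lmodType k) (e : 'I_n -> B) : Prop :=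
  forall r : 'rV[k]_n, \sum_i r 0 i *: e i = 0 -> r = 0.

Definition lin_basis (B : lmodType k) (e : 'I_n -> B) : Prop :=
  lin_free e /\ forall b, exists r : 'rV[k]_n, b = \sum_i r 0 i *: e i.

(** B embeds linearly into k^n. *)
Definition has_coords (B : lmodType k) : Prop :=
  exists L : B -> 'rV[k]_n,
    (forall c a b, L (c *: a + b) = c *: L a + L b) /\ forall b, L b = 0 -> b = 0.

(** In a space of dimension at most n, a free family of n vectors spans. *)
Lemma coords_basis (B : lmodType k) (e : 'I_n -> B) :
  has_coords B -> lin_free e -> lin_basis e.
Proof.
move=> [L0 [L0P Linj]] efree; split=> // b.
pose L : {linear B -> 'rV[k]_n} := HB.pack L0 (GRing.isLinear.Build k _ _ _ L0 L0P).
have LE x : L0 x = L x by [].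
pose M := \matrix_(i, j) L (e i) 0 j.
have LM (r : 'rV[k]_n) : r *m M = L (\sum_i r 0 i *: e i).
  rewrite linear_sum; apply/rowP => j; rewrite !mxE summxE.
  by apply: eq_bigr => i _; rewrite mxE linearZ mxE.
have Mfree : row_free M.
  apply: inj_row_free => r; rewrite LM => /Linj; exact: efree.
rewrite row_free_unit -row_full_unit in Mfree.
have /submxP[r Lb] : (L b <= M)%MS by apply: submx_full.
exists r; apply/eqP; rewrite -subr_eq0; apply/eqP/Linj.
have LB y z : L (y - z) = L y - L z by exact: linearB.
by rewrite LE LB Lb LM subrr.
Qed.

Lemma basis_coords (B : lmodType k) (e : 'I_n -> B) :
  lin_basis e -> has_coords B.
Proof.
move=> [efree espan].
have espan' (b : B) : exists r : 'rV[k]_n, b == \sum_i r 0 i *: e i.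
  by have [r ->] := espan b; exists r.
pose L (b : B) : 'rV[k]_n := xchoose (espan' b).
have LE (b : B) : b = \sum_i L b 0 i *: e i by apply/eqP/(xchooseP (espan' b)).
have L_uniq (b : B) (r : 'rV[k]_n) : b = \sum_i r 0 i *: e i -> L b = r.
  move=> br; apply/eqP; rewrite -subr_eq0; apply/eqP/efree.
  under eq_bigr do rewrite !mxE scalerBl.
  by rewrite sumrB -br -LE subrr.
exists L; split=> [c a b|b Lb0].
  apply: L_uniq; under eq_bigr do rewrite !mxE scalerDl -scalerA.
  by rewrite big_split -scaler_sumr -!LE.
by rewrite (LE b) Lb0 big1 // => i _; rewrite mxE scale0r.
Qed.

(** In a finite-dimensional algebra a regular element f is a unit: f times a
    basis is free, hence a basis, and 1 is a combination of it. *)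
Lemma regular_unit (B : algType k) (e : 'I_n -> B) (f : B) :
  lin_basis e -> (forall b, f * b = 0 -> b = 0) -> exists g, f * g = 1.
Proof.
move=> eb freg.
have [] := @coords_basis B (fun i => f * e i) (basis_coords eb).
  move=> r r0; apply: eb.1; apply: freg; rewrite -{}[RHS]r0 mulr_sumr.
  by apply: eq_bigr => i _; rewrite scalerAr.
move=> _ /(_ 1)[r ->]; exists (\sum_i r 0 i *: e i); rewrite mulr_sumr.
by apply: eq_bigr => i _; rewrite scalerAr.
Qed.

End Basis.

Section Polynomials.
Variables (k : fieldType) (n : nat).

Lemma mpoly_gen_ind (P : mpoly n k -> Prop) :
  P 1 -> (forall p q, P p -> P q -> P (p + q)) ->
  (forall c p, P p -> P (c *: p)) -> (forall i p, P p -> P ('X_i * p)) ->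
  forall p, P p.
Proof.
move=> P1 PD PZ PX p; rewrite (mpolyE p).
have P0 : P 0 by rewrite -(scale0r 1); apply: PZ.
apply: (big_ind P) => // m _; apply: PZ; rewrite mpolyXE_id.
suff PXn i j r : P r -> P ('X_i ^+ j * r).
  elim: (index_enum _) => [|i l IHl]; first by rewrite big_nil.
  by rewrite big_cons; apply: PXn.
move=> Pr; elim: j => [|j IHj]; first by rewrite mul1r.
by rewrite exprS -mulrA; apply: PX.
Qed.

Lemma mpoly_hom (B : algType k) (h : 'I_n -> B) :
  (forall a b : B, a * b = b * a) ->
  exists phi : {lrmorphism mpoly n k -> B}, forall i, phi 'X_i = h i.
Proof.
move=> BC; pose f : mpoly n k -> B := mmap (in_alg B) h.
have fM : multiplicative f.
  apply: commr_mmap_is_multiplicative => [i x|p m m']; exact: BC.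
have [c p q||p q|g gE] := @lrmorphism_of k (mpoly n k) B f.
- by rewrite /f raddfD /= mmapZ /= mulr_algl.
- exact: fM.2.
- exact: fM.1.
by exists g => i; rewrite gE /f mmapX mmap1U.
Qed.

End Polynomials.

(** * Two quadratic relations in three variables *)

(** The coefficients of a pair of relations u^2 = a w^2 + b wu + c wv + d uv
    and v^2 = a' w^2 + b' wu + c' wv. The second one has no term in uv, so the
    two relations reduce every monomial to a multiple of 1, u, v or uv. *)
Record quad_rels (k : fieldType) := QuadRels {
  uu_ww : k; uu_wu : k; uu_wv : k; uu_uv : k;
  vv_ww : k; vv_wu : k; vv_wv : k
}.

Section QuadRels.
Variables (k : fieldType) (Q : quad_rels k).

(** The difference of the two sides of each relation, evaluated at elements w,
    u, v of an algebra. *)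
Definition rel_u (A : algType k) (w u v : A) : A :=
  u * u - (uu_ww Q *: (w * w) + uu_wu Q *: (w * u) + uu_wv Q *: (w * v)
           + uu_uv Q *: (u * v)).

Definition rel_v (A : algType k) (w u v : A) : A :=
  v * v - (vv_ww Q *: (w * w) + vv_wu Q *: (w * u) + vv_wv Q *: (w * v)).

Section Hom.
Variables (A B : algType k) (phi : {lrmorphism A -> B}).

Lemma rel_u_hom w u v :
  phi (rel_u w u v) = rel_u (phi w) (phi u) (phi v).
Proof. by rewrite lrmorphB !(lrmorphD, lrmorphZ, lrmorphM). Qed.

Lemma rel_v_hom w u v :
  phi (rel_v w u v) = rel_v (phi w) (phi u) (phi v).
Proof. by rewrite lrmorphB !(lrmorphD, lrmorphZ, lrmorphM). Qed.

End Hom.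

Lemma rel_uZ (A : algType k) l (w u v : A) :
  rel_u (l *: w) (l *: u) (l *: v) = l ^+ 2 *: rel_u w u v.
Proof.
have lC c : c * l * l = l ^+ 2 * c by rewrite expr2 -mulrA mulrC.
rewrite /rel_u -!scalerAl -!scalerAr !scalerA !lC.
by rewrite scalerBr !scalerDr !scalerA expr2.
Qed.

Lemma rel_vZ (A : algType k) l (w u v : A) :
  rel_v (l *: w) (l *: u) (l *: v) = l ^+ 2 *: rel_v w u v.
Proof.
have lC c : c * l * l = l ^+ 2 * c by rewrite expr2 -mulrA mulrC.
rewrite /rel_v -!scalerAl -!scalerAr !scalerA !lC.
by rewrite scalerBr !scalerDr !scalerA expr2.
Qed.

(** The family 1, u, v, uv. *)
Definition basis_seq (A : algType k) (u v : A) (i : 'I_4) : A :=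
  nth 0 [:: 1; u; v; u * v] i.

Lemma basis_sum (A : algType k) (u v : A) (r : 'I_4 -> k) :
  \sum_i r i *: basis_seq u v i =
  r 0 *: 1 + r 1 *: u + r 2%:R *: v + r 3%:R *: (u * v).
Proof.
rewrite !big_ord_recl big_ord0 addr0 !addrA /basis_seq /=.
by do ![congr (_ + _)]; congr (r _ *: _); apply: val_inj.
Qed.

Section Span.
Variables (A : algType k) (w u v : A).
Hypotheses (AC : forall x y : A, x * y = y * x)
  (ru : rel_u w u v = 0) (rv : rel_v w u v = 0).

Let H : {poly k} -> A := horner_alg w.

Let HX : H 'X = w. Proof. exact: horner_algX. Qed.

(** The k[w]-span of 1, u, v, uv. *)
Definition spanned (x : A) : Prop :=
  exists p : {poly k} * {poly k} * {poly k} * {poly k},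
  x = H p.1.1.1 + H p.1.1.2 * u + H p.1.2 * v + H p.2 * (u * v).

Lemma spannedD x y : spanned x -> spanned y -> spanned (x + y).
Proof.
move=> [[[[p0 p1] p2] p3] /= ->] [[[[q0 q1] q2] q3] /= ->].
exists (p0 + q0, p1 + q1, p2 + q2, p3 + q3) => /=.
rewrite /H !rmorphD !mulrDl.
by do 2![rewrite addrACA; congr (_ + _)]; rewrite addrACA.
Qed.

Lemma spannedM p x : spanned x -> spanned (H p * x).
Proof.
move=> [[[[p0 p1] p2] p3] /= ->]; exists (p * p0, p * p1, p * p2, p * p3) => /=.
by rewrite /H !rmorphM !mulrDr !mulrA.
Qed.

Lemma spannedZ c x : spanned x -> spanned (c *: x).
Proof.
by move=> /(spannedM c%:P); rewrite /H horner_algC mulr_algl.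
Qed.

Lemma spannedW x : spanned x -> spanned (w * x).
Proof. by rewrite -HX; apply: spannedM. Qed.

Lemma spanned1 : spanned 1.
Proof. by exists (1, 0, 0, 0); rewrite /H /= rmorph1 rmorph0 !mul0r !addr0. Qed.

Lemma spannedu : spanned u.
Proof.
by exists (0, 1, 0, 0); rewrite /H /= rmorph1 rmorph0 !mul0r !addr0 add0r mul1r.
Qed.

Lemma spannedv : spanned v.
Proof.
by exists (0, 0, 1, 0); rewrite /H /= rmorph1 rmorph0 !mul0r !addr0 !add0r mul1r.
Qed.

Lemma spanneduv : spanned (u * v).
Proof.
by exists (0, 0, 0, 1); rewrite /H /= rmorph1 rmorph0 !mul0r !add0r mul1r.
Qed.

Let mulCA x y z : x * (y * z) = y * (x * z) :> A.
Proof. by rewrite !mulrA (AC x). Qed.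

Lemma spanneduu : spanned (u * u).
Proof.
move/eqP: ru; rewrite subr_eq0 => /eqP ->.
do ![apply: spannedD]; apply: spannedZ; try apply: spannedW.
- by rewrite -[w]mulr1; apply/spannedW/spanned1.
- exact: spannedu.
- exact: spannedv.
- exact: spanneduv.
Qed.

Lemma spannedvv : spanned (v * v).
Proof.
move/eqP: rv; rewrite subr_eq0 => /eqP ->.
do ![apply: spannedD]; apply: spannedZ; apply: spannedW.
- by rewrite -[w]mulr1; apply/spannedW/spanned1.
- exact: spannedu.
- exact: spannedv.
Qed.

(** v uv = u v^2 involves u^2 but no longer v^2, so it reduces by
    [spanneduu]; u uv = u^2 v then reduces by this lemma. *)
Lemma spanneduvv : spanned (v * (u * v)).
Proof.
rewrite mulCA; move/eqP: rv; rewrite subr_eq0 => /eqP ->.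
rewrite !mulrDr -!scalerAr ![u * (w * _)]mulCA.
do ![apply: spannedD]; apply: spannedZ; apply: spannedW.
- by rewrite AC; apply/spannedW/spannedu.
- exact: spanneduu.
- exact: spanneduv.
Qed.

Lemma spanneduuv : spanned (u * (u * v)).
Proof.
rewrite mulrA; move/eqP: ru; rewrite subr_eq0 => /eqP ->.
rewrite !mulrDl -!scalerAl -!mulrA.
do ![apply: spannedD]; apply: spannedZ; try apply: spannedW.
- exact/spannedW/spannedv.
- exact: spanneduv.
- exact: spannedvv.
- by rewrite mulCA; apply: spanneduvv.
Qed.

Lemma spannedU x : spanned x -> spanned (u * x).
Proof.
move=> [[[[p0 p1] p2] p3] /= ->]; rewrite !mulrDr [u * H p0]AC ![u * (H _ * _)]mulCA.
do ![apply: spannedD]; apply: spannedM.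
- exact: spannedu.
- exact: spanneduu.
- exact: spanneduv.
- exact: spanneduuv.
Qed.

Lemma spannedV x : spanned x -> spanned (v * x).
Proof.
move=> [[[[p0 p1] p2] p3] /= ->]; rewrite !mulrDr [v * H p0]AC ![v * (H _ * _)]mulCA.
do ![apply: spannedD]; apply: spannedM.
- exact: spannedv.
- by rewrite AC; apply: spanneduv.
- exact: spannedvv.
- exact: spanneduvv.
Qed.

(** The evaluations at (l, l hu, l hv) for l != 0 are jointly injective on the
    span: each one gives the four coefficients at l, by freeness of 1, hu, hv,
    hu hv, and a polynomial vanishing at all l != 0 is zero. *)
Lemma spanned_eval_inj (B : algType k) (hu hv : B) x :
  (forall p : {poly k}, (forall l, l != 0 -> p.[l] = 0) -> p = 0) ->
  lin_free (basis_seq hu hv) -> spanned x ->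
  (forall l, l != 0 -> exists phi : {lrmorphism A -> B},
     [/\ phi w = l *: 1, phi u = l *: hu, phi v = l *: hv & phi x = 0]) ->
  x = 0.
Proof.
move=> kinf hfree [[[[p0 p1] p2] p3] /= xE] phix.
have phiH (phi : {lrmorphism A -> B}) l p : phi w = l *: 1 -> phi (H p) = p.[l] *: 1.
  move=> phiw; elim/poly_ind: p => [|p c IHp].
    by rewrite /H rmorph0 lrmorph0 horner0 scale0r.
  rewrite /H rmorphD rmorphM /= horner_algC horner_algX lrmorphD lrmorphM.
  by rewrite IHp lrmorphZ lrmorph1 phiw hornerMXaddC scalerDl -scalerAl mul1r scalerA.
suff p0l l : l != 0 -> [/\ p0.[l] = 0, p1.[l] = 0, p2.[l] = 0 & p3.[l] = 0].
  have z0 : p0 = 0 by apply: kinf => l /p0l[].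
  have z1 : p1 = 0 by apply: kinf => l /p0l[].
  have z2 : p2 = 0 by apply: kinf => l /p0l[].
  have z3 : p3 = 0 by apply: kinf => l /p0l[].
  by rewrite xE z0 z1 z2 z3 /H !rmorph0 !mul0r !addr0.
move=> l0; have [phi [pw pu pv]] := phix l l0.
rewrite xE !(lrmorphD, lrmorphM, pu, pv) !(phiH phi l) // => phi0.
pose r : 'rV[k]_4 := \row_(i < 4)
  nth 0 [:: p0.[l]; p1.[l] * l; p2.[l] * l; p3.[l] * (l * l)] i.
have /hfree r0 : \sum_i r 0 i *: basis_seq hu hv i = 0.
  rewrite basis_sum !mxE /= -[RHS]phi0.
  by rewrite -!scalerAl -!scalerAr !mul1r !scalerA.
have rE i : r 0 i = 0 by rewrite r0 mxE.
move: (rE 0) (rE 1) (rE 2%:R) (rE 3%:R); rewrite !mxE /= => -> /eqP + /eqP + /eqP.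
rewrite !mulf_eq0 !(negPf l0) !orbF => /eqP-> /eqP-> /eqP->; by [].
Qed.

End Span.
End QuadRels.

(** * The dual of a conic and its evaluations in a finite algebra *)

Lemma bij_of_inj_surj (A B : choiceType) (f : A -> B) :
  injective f -> (forall y, exists x, f x = y) -> bijective f.
Proof.
move=> finj fsurj; have fsurj' y : exists x, f x == y.
  by have [x <-] := fsurj y; exists x.
have gK y : f (xchoose (fsurj' y)) = y by apply/eqP/(xchooseP (fsurj' y)).
by exists (fun y => xchoose (fsurj' y)) => [x|y //]; apply: finj.
Qed.

Lemma quot_pi_hom (k : fieldType) (A : algType k) (G : A -> Prop)
    (proper : ~ ideal G 1) :
  exists p : {lrmorphism A -> quot proper}, p =1 quot_pi proper.
Proof.
apply: lrmorphism_of => // [c a b|a b]; last exact: quot_piM.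
by rewrite quot_piD quot_piZ.
Qed.

Lemma lrmorph_comb4 (k : fieldType) (A B : algType k)
    (phi : {lrmorphism A -> B}) c0 c1 c2 c3 a0 a1 a2 a3 :
  phi (c0 *: a0 + c1 *: a1 + c2 *: a2 + c3 *: a3) =
  c0 *: phi a0 + c1 *: phi a1 + c2 *: phi a2 + c3 *: phi a3.
Proof. by rewrite !(lrmorphD, lrmorphZ). Qed.

Section Core.
Variables (k : fieldType) (s : seq (freeAlg k 3)) (f t0 : freeAlg k 3).
Variables (q : seq (mpoly 3 k)) (Q : quad_rels k) (w u v : 'I_3).
Local Notation x := (@free_gen k 3).
Local Notation A := (qdual (f :: s)).
Local Notation g := (@qdual_gen k 3 (f :: s)).

(** The dual of S/(f), where S has relations s, is k[x,y,z]/(q), whose ideal is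
    also generated by the two relations Q in the variables w, u, v. Here
    [pr_span] says that, modulo commutators, every quadratic relation of the
    dual is a combination of these two, and t0 is a tensor that represents f^!:
    it vanishes in the dual of S and is not orthogonal to f. *)
Record presentation : Prop := Presentation {
  pr_cover : forall i, [\/ i = w, i = u | i = v];
  pr_sym : forall r, r \in f :: s -> symmetric2 r;
  pr_u : perp (f :: s) (rel_u Q (x w) (x u) (x v));
  pr_v : perp (f :: s) (rel_v Q (x w) (x u) (x v));
  pr_span : forall t, perp (f :: s) t -> exists c1 c2 : k,
    \sum_i \sum_j coef2 t i j *: ('X_i * 'X_j : mpoly 3 k) =
    c1 *: rel_u Q ('X_w : mpoly 3 k) 'X_u 'X_v
    + c2 *: rel_v Q ('X_w : mpoly 3 k) 'X_u 'X_v;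
  pr_ideal_u : ideal (fun p => p \in q) (rel_u Q ('X_w : mpoly 3 k) 'X_u 'X_v);
  pr_ideal_v : ideal (fun p => p \in q) (rel_v Q ('X_w : mpoly 3 k) 'X_u 'X_v);
  pr_rels : forall p, p \in q -> exists c1 c2 : k,
    p = c1 *: rel_u Q ('X_w : mpoly 3 k) 'X_u 'X_v
        + c2 *: rel_v Q ('X_w : mpoly 3 k) 'X_u 'X_v;
  pr_t0 : perp s t0;
  pr_t0f : pairing t0 f != 0
}.

Section Model.
Variables (B : algType k) (h : 'I_3 -> B).

(** The value of a tensor of degree two at the point h. *)
Definition quad_eval (t : freeAlg k 3) : B :=
  \sum_i \sum_j coef2 t i j *: (h i * h j).

(** B is the ring of functions on the scheme of solutions of Q with w = 1, the
    variables being the functions h, and t0 vanishes nowhere on it. *)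
Record model : Prop := Model {
  md_C : forall a b : B, a * b = b * a;
  md_w : h w = 1;
  md_u : rel_u Q 1 (h u) (h v) = 0;
  md_v : rel_v Q 1 (h u) (h v) = 0;
  md_basis : lin_basis (basis_seq (h u) (h v));
  md_t0 : exists b, quad_eval t0 * b = 1
}.

Hypothesis kinf : forall p : {poly k}, (forall l, l != 0 -> p.[l] = 0) -> p = 0.
Hypotheses (pres : presentation) (mod_ : model).

Let AC : forall a b : A, a * b = b * a := qdual_mulC (pr_sym pres).

Let mpoly_ev l : exists phi : {lrmorphism mpoly 3 k -> B},
  [/\ forall i, phi 'X_i = l *: h i,
      phi (rel_u Q 'X_w 'X_u 'X_v) = 0 & phi (rel_v Q 'X_w 'X_u 'X_v) = 0].
Proof.
have [phi phiE] := mpoly_hom (fun i => l *: h i) (md_C mod_).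
exists phi; split=> //.
  by rewrite rel_u_hom !phiE rel_uZ (md_w mod_) (md_u mod_) scaler0.
by rewrite rel_v_hom !phiE rel_vZ (md_w mod_) (md_v mod_) scaler0.
Qed.

Let ev l : exists phi : {lrmorphism A -> B}, forall i, phi (g i) = l *: h i.
Proof.
apply: qdual_hom => t /(pr_span pres)[c1 [c2 tE]].
have [phi [phiE pu pv]] := mpoly_ev l.
transitivity (phi (\sum_i \sum_j coef2 t i j *: ('X_i * 'X_j))).
  rewrite lrmorph_sum; apply: eq_bigr => i _.
  rewrite lrmorph_sum; apply: eq_bigr => j _.
  by rewrite lrmorphZ lrmorphM !phiE.
by rewrite tE lrmorphD !lrmorphZ pu pv !scaler0 addr0.
Qed.

Let gru : rel_u Q (g w) (g u) (g v) = 0.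
Proof.
have [p pE] := quot_pi_hom (@perp_proper k 3 (f :: s)).
have := rel_u_hom Q p (x w) (x u) (x v); rewrite !pE => <-.
exact: qdual_pi_eq0 (pr_u pres).
Qed.

Let grv : rel_v Q (g w) (g u) (g v) = 0.
Proof.
have [p pE] := quot_pi_hom (@perp_proper k 3 (f :: s)).
have := rel_v_hom Q p (x w) (x u) (x v); rewrite !pE => <-.
exact: qdual_pi_eq0 (pr_v pres).
Qed.

Let all_spanned a : spanned (g w) (g u) (g v) a.
Proof.
elim/qdual_ind: a => [|a b|c a|i a].
- exact: spanned1.
- exact: spannedD.
- exact: spannedZ.
move=> sa; case: (pr_cover pres i) => ->.
- exact: spannedW sa.
- exact: spannedU AC gru grv _ sa.
- exact: spannedV AC gru grv _ sa.
Qed.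

Let eval_inj a :
  (forall l, l != 0 -> exists2 phi : {lrmorphism A -> B},
     (forall i, phi (g i) = l *: h i) & phi a = 0) -> a = 0.
Proof.
move=> phia.
apply: (spanned_eval_inj kinf (md_basis mod_).1 (all_spanned a)) => l l0.
by have [phi phiE pa] := phia l l0; exists phi; rewrite !phiE (md_w mod_).
Qed.

(** The map from A^! to k[x,y,z]/(q) is injective, because the evaluations,
    which are jointly injective on A^!, factor through it. *)
Lemma quadratic_dual_is : qdual_is (f :: s) q.
Proof.
have killq l (phi : {lrmorphism mpoly 3 k -> B}) :
    [/\ forall i, phi 'X_i = l *: h i,
      phi (rel_u Q 'X_w 'X_u 'X_v) = 0 & phi (rel_v Q 'X_w 'X_u 'X_v) = 0] ->
    forall p, p \in q -> phi p = 0.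
  move=> [_ pu pv] p /(pr_rels pres)[c1 [c2 ->]].
  by rewrite lrmorphD !lrmorphZ pu pv !scaler0 addr0.
have q_proper : ~ ideal (fun p => p \in q) 1.
  have [phi phiP] := mpoly_ev 1.
  exact: (ideal_proper (e := phi)) (killq 1 phi phiP).
exists q_proper.
have [qpi qpiE] := quot_pi_hom q_proper.
have qpi0 p : ideal (fun p => p \in q) p -> qpi p = 0.
  by move=> pq; rewrite qpiE; apply/quot_piP; rewrite subr0.
have [|phi phiE] := @qdual_hom k 3 (f :: s) (quot q_proper) (fun i => qpi 'X_i).
  move=> t /(pr_span pres)[c1 [c2 tE]].
  transitivity (qpi (\sum_i \sum_j coef2 t i j *: ('X_i * 'X_j))).
    rewrite lrmorph_sum; apply: eq_bigr => i _.
    rewrite lrmorph_sum; apply: eq_bigr => j _.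
    by rewrite lrmorphZ lrmorphM.
  rewrite tE lrmorphD !lrmorphZ (qpi0 _ (pr_ideal_u pres)).
  by rewrite (qpi0 _ (pr_ideal_v pres)) !scaler0 addr0.
exists phi; split; last by move=> i; rewrite phiE qpiE.
have phi_inj a : phi a = 0 -> a = 0.
  move=> pa; apply: eval_inj => l _; have [e eE] := ev l; exists e => //.
  have [m mP] := mpoly_ev l; have [m' m'E] := quot_hom q_proper (killq l m mP).
  suff -> : e a = m' (phi a) by rewrite pa lrmorph0.
  elim/qdual_ind: a {pa} => [|a b ha hb|c a ha|i a ha].
  - by rewrite !lrmorph1.
  - by rewrite !lrmorphD ha hb.
  - by rewrite !lrmorphZ ha.
  - by rewrite !lrmorphM ha eE phiE qpiE m'E; case: mP => ->.
apply: bij_of_inj_surj => [a b ab|].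
  by apply/eqP; rewrite -subr_eq0; apply/eqP/phi_inj; rewrite lrmorphB ab subrr.
elim/quot_ind => p; rewrite -qpiE.
elim/mpoly_gen_ind: p => [|p1 p2 [a1 h1] [a2 h2]|c p [a ha]|i p [a ha]].
- by exists 1; rewrite !lrmorph1.
- by exists (a1 + a2); rewrite !lrmorphD h1 h2.
- by exists (c *: a); rewrite !lrmorphZ ha.
- by exists (g i * a); rewrite !lrmorphM ha phiE.
Qed.

(** On a homogeneous element the evaluation at l is a multiple of the one at 1,
    so the latter is injective in each degree. *)
Let homog_inj (phi : {lrmorphism A -> B}) d a :
  (forall i, phi (g i) = h i) -> qdual_homog d a -> phi a = 0 -> a = 0.
Proof.
move=> phiE ha pa; apply: eval_inj => l _; have [e eE] := ev l.
exists e => //; rewrite (qdual_homog_eval (g := phi) (c := l) _ ha) ?pa ?scaler0 //.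
by move=> i; rewrite eE phiE.
Qed.

(** The evaluation at 1 maps the piece of degree two onto B: the basis 1, U, V,
    UV lifts to w^2, wu, wv, uv. *)
Let quad_lift b : exists2 a : A, qdual_homog 2 a &
  forall phi : {lrmorphism A -> B}, (forall i, phi (g i) = h i) -> phi a = b.
Proof.
have [r rb] := (md_basis mod_).2 b.
have [G hG phiG] : exists2 G : 'I_3 -> 'I_3 -> A, forall i j, qdual_homog 2 (G i j) &
    forall phi : {lrmorphism A -> B}, (forall i, phi (g i) = h i) ->
    forall i j, phi (G i j) = h i * h j.
  exists (fun i j => qdual_pi (f :: s) (gen2 k i j)) => [i j|phi phiE i j].
    by exists (gen2 k i j) => //; apply: homog_genM.
  by rewrite qdual_gen2 lrmorphM !phiE.
exists (r 0 0 *: G w w + r 0 1 *: G w u + r 0 2%:R *: G w v + r 0 3%:R *: G u v).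
  by do ![apply: qdual_homogD]; apply: qdual_homogZ.
move=> phi phiE; rewrite lrmorph_comb4 rb basis_sum -(phiG phi phiE u v); congr (_ + _).
by rewrite !(phiG phi phiE) (md_w mod_) !mul1r.
Qed.

Let dual_elt : is_dual_elt s f (qdual_pi (f :: s) t0).
Proof.
have t0h := (pr_t0 pres).1.
have fd0 : qdual_homog 2 (qdual_pi (f :: s) t0) by exists t0.
split=> //.
  split=> [a|a fa]; first exact: AC.
  have [phi phiE] := ev 1.
  have phiE1 i : phi (g i) = h i by rewrite phiE scale1r.
  apply: eval_inj => l l0; have [e eE] := ev l; exists e => //.
  have := congr1 e fa; rewrite lrmorphM lrmorph0.
  rewrite (qdual_homog_eval (g := phi) (c := l) _ fd0); last first.
    by move=> i; rewrite eE phiE1.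
  rewrite -scalerAl => /eqP; rewrite scaler_eq0 expf_eq0 (negPf l0) => /eqP pa.
  have [b tb] := md_t0 mod_.
  have phit : phi (qdual_pi (f :: s) t0) = quad_eval t0.
    have [p pE] := quot_pi_hom (@perp_proper k 3 (f :: s)).
    rewrite {1}(homog_sumE t0h) /qdual_pi -pE lrmorph_sum lrmorph_sum.
    apply: eq_bigr => i _; rewrite !lrmorph_sum; apply: eq_bigr => j _.
    by rewrite !lrmorphZ pE [quot_pi _ _]qdual_gen2 lrmorphM !phiE1.
  by rewrite -[e a]mul1r -tb (md_C mod_ _ b) -mulrA -phit pa mulr0.
move=> t; have idl := @ideal_gen k A (fun a => a = qdual_pi (f :: s) t0) _ erefl.
have [p pE] := quot_pi_hom (@perp_proper k 3 (f :: s)).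
have [p' p'E] := quot_pi_hom (@perp_proper k 3 s).
split=> [/quot_piP|].
  rewrite subr0 /qdual_pi -(pE t); elim=> [r rs||a b _ ha _ hb|c a _ ha|a c _ ha].
  (* on perp s the pairing with f has kernel perp (f :: s), so t0 spans the
     quotient *)
  - pose c := pairing r f / pairing t0 f.
    have : perp (f :: s) (r - c *: t0).
      split; first by apply: free_homogD rs.1 (free_homogN _); apply: free_homogZ.
      move=> r'; rewrite inE -/(pairing _ _) pairingDl pairingNl pairingZl.
      case/orP => [/eqP ->|r's]; first by rewrite divfK ?subrr ?(pr_t0f pres).
      have:= (pr_t0 pres).2 _ r's; rewrite -/(pairing _ _) => ->.
      have:= rs.2 _ r's; rewrite -/(pairing _ _) => ->.
      by rewrite mulr0 subr0.
    move/qdual_pi_eq0; rewrite /qdual_pi -pE lrmorphB lrmorphZ => /eqP.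
    by rewrite subr_eq0 => /eqP ->; apply: ideal_scale; rewrite pE.
  - by rewrite lrmorph0; apply: ideal_zero.
  - by rewrite lrmorphD; apply: ideal_add.
  - by rewrite lrmorphM; apply: ideal_mull.
  - by rewrite lrmorphM; apply: ideal_mulr.
have [|m mE] := @quot_hom k _ _ _ (@perp_proper k 3 (f :: s)) p'.
  move=> r [rh rfs]; rewrite p'E; apply: (@qdual_pi_eq0 k 3 s); split=> // r' r's.
  by apply: rfs; rewrite inE r's orbT.
rewrite /qdual_pi -(p'E t) -mE.
move=> idt; apply: (ideal_ker _ idt) => _ ->.
by rewrite /= mE p'E; apply: (@qdual_pi_eq0 k 3 s); exact: (pr_t0 pres).
Qed.

Section Iso.
Variables (fd : A) (fdP : is_dual_elt s f fd).

Let fh := dual_elt_homog fdP.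

(** The inverse of the value of fd exists: multiplication by it is injective on
    B, since an element of B lifts to degree two and fd is regular. *)
Lemma C_alg_iso : alg_iso (C_alg fdP) B.
Proof.
have [phi phiE1] := ev 1.
have phiE i : phi (g i) = h i by rewrite phiE1 scale1r.
have BC := md_C mod_.
have [gi Fg] : exists b, phi fd * b = 1.
  apply: (regular_unit (md_basis mod_)) => b.
  have [a ah /(_ phi phiE) <-] := quad_lift b.
  rewrite -lrmorphM => /(homog_inj phiE (qdual_homogM fh ah)).
  by move=> /((dual_elt_reg fdP).2) ->; apply: lrmorph0.
have Fgn n : phi fd ^+ n * gi ^+ n = 1.
  by rewrite -exprMn_comm ?Fg ?expr1n //; apply: BC.
have phiMX a n : phi (fd ^+ n * a) = phi fd ^+ n * phi a.
  by rewrite lrmorphM; congr (_ * _); apply: rmorphXn.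
(* F is a / fd^n |-> phi a / phi fd^n, computed on representatives *)
pose F (x : qdual_loc fdP) : B :=
  phi (generic_quotient.repr x).1 * gi ^+ (generic_quotient.repr x).2.
have FE a n : F (loc_frac (dual_elt_reg fdP) a n) = phi a * gi ^+ n.
  have := repr_loc_frac (dual_elt_reg fdP) a n; rewrite /F.
  case: (generic_quotient.repr _) => [b m] /= /(congr1 phi) ab.
  have {}ab := etrans (esym (phiMX b n)) (etrans ab (phiMX a m)).
  rewrite -[phi b]mul1r -(Fgn n) (BC (_ ^+ n)) -(mulrA (gi ^+ n)) ab.
  by rewrite (BC _ (phi a)) mulrA (BC _ (phi a)) -!mulrA Fgn mulr1.
have FD c x y : F (c *: x + y) = c *: F x + F y.
  move: x y; apply: loc_ind2 => a b n.
  by rewrite -loc_fracZ -loc_fracD !FE lrmorphD lrmorphZ mulrDl scalerAl.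
have FM x y : F (x * y) = F x * F y.
  move: x y; apply: loc_ind2 => a b n.
  rewrite -loc_fracM !FE lrmorphM exprD -!mulrA; congr (_ * _).
  by rewrite !mulrA (BC (gi ^+ n)).
have F1 : F 1 = 1.
  by rewrite -[1]/(loc_frac (dual_elt_reg fdP) 1 0) FE lrmorph1 mulr1.
have [G GE] : exists G : {lrmorphism C_alg fdP -> B},
    forall x, G x = F (val x).
  by apply: lrmorphism_of => [c x y||x y] /=; [exact: FD|exact: F1|exact: FM].
exists G; apply: bij_of_inj_surj => [x y xy|b].
  apply/eqP; rewrite -subr_eq0; apply/eqP/val_inj.
  have : G (x - y) = 0 by rewrite lrmorphB xy subrr.
  rewrite GE; case: (x - y) => z /= /loc_deg0P[a [n [ah ->]]].
  rewrite FE => /(congr1 (fun b => b * phi fd ^+ n)).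
  rewrite mul0r -mulrA (BC (gi ^+ n)) Fgn mulr1 => /(homog_inj phiE ah) ->.
  by apply/loc_fracP; rewrite !mulr0.
have [a ah /(_ phi phiE) pa] := quad_lift (b * phi fd).
have aP : qdual_frac fdP a 1 \in loc_deg0 (fdP := fdP).
  by apply/loc_deg0P; exists a, 1%N.
exists (exist (fun z => z \in loc_deg0 (fdP := fdP)) _ aP : C_alg fdP).
by rewrite GE /= FE pa expr1 -mulrA Fg mulr1.
Qed.

End Iso.

Lemma C_is_model : C_is s f B.
Proof. by split; [eexists; exact: dual_elt|exact: C_alg_iso]. Qed.

End Model.
End Core.

(** * Skew relations with a diagonal form, and their orthogonal complements *)

Lemma sum3 (V : nmodType) (F : 'I_3 -> V) : \sum_i F i = F i0 + F i1 + F i2.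
Proof.
rewrite !big_ord_recl big_ord0 addr0 addrA.
by congr (F _ + F _ + F _); apply: val_inj.
Qed.

Lemma ord3P (i : 'I_3) : [\/ i = i0, i = i1 | i = i2].
Proof.
case: i => [[|[|[|]]]] // lti; [constructor 1|constructor 2|constructor 3];
  exact: val_inj.
Qed.

Section Relations.
Variable k : fieldType.
Local Notation g := (gen2 k).
Local Notation x := (@free_gen k 3).

(** The relations xy + yx, yz + zy + e1 x^2, zx + xz + e2 y^2, common to the
    three quantum polynomial algebras. *)
Definition skew_rels (e1 e2 : k) : seq (freeAlg k 3) :=
  [:: g i0 i1 + g i1 i0; g i1 i2 + g i2 i1 + e1 *: g i0 i0;
      g i2 i0 + g i0 i2 + e2 *: g i1 i1].

(** The form a x^2 + b y^2 + c z^2. *)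
Definition diag_form (a b c : k) : freeAlg k 3 :=
  a *: g i0 i0 + b *: g i1 i1 + c *: g i2 i2.

Lemma rel_uE (Q : quad_rels k) i j l : rel_u Q (x i) (x j) (x l) =
  g j j - (uu_ww Q *: g i i + uu_wu Q *: g i j + uu_wv Q *: g i l
           + uu_uv Q *: g j l).
Proof. by rewrite gen2E. Qed.

Lemma rel_vE (Q : quad_rels k) i j l : rel_v Q (x i) (x j) (x l) =
  g l l - (vv_ww Q *: g i i + vv_wu Q *: g i j + vv_wv Q *: g i l).
Proof. by rewrite gen2E. Qed.

Section Linear.
Variables (V : lmodType k) (phi : V -> k).
Hypotheses (phiD : forall a b, phi (a + b) = phi a + phi b)
  (phiZ : forall c a, phi (c *: a) = c * phi a).

Lemma lin_rel a b c e : phi (a + b + c *: e) = phi a + phi b + c * phi e.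
Proof. by rewrite !phiD phiZ. Qed.

Lemma lin_comb3 c1 c2 c3 a1 a2 a3 :
  phi (c1 *: a1 + c2 *: a2 + c3 *: a3) = c1 * phi a1 + c2 * phi a2 + c3 * phi a3.
Proof. by rewrite !phiD !phiZ. Qed.

Lemma lin_sub3 b c1 c2 c3 a1 a2 a3 :
  phi (b - (c1 *: a1 + c2 *: a2 + c3 *: a3)) =
  phi b - (c1 * phi a1 + c2 * phi a2 + c3 * phi a3).
Proof. by rewrite -scaleN1r phiD phiZ lin_comb3 mulN1r. Qed.

Lemma lin_sub4 b c1 c2 c3 c4 a1 a2 a3 a4 :
  phi (b - (c1 *: a1 + c2 *: a2 + c3 *: a3 + c4 *: a4)) =
  phi b - (c1 * phi a1 + c2 * phi a2 + c3 * phi a3 + c4 * phi a4).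
Proof. by rewrite -scaleN1r phiD phiZ lin_rel phiD !phiZ mulN1r. Qed.

End Linear.

Implicit Types t : freeAlg k 3.

Lemma pairing_pair t i j l m :
  pairing t (g i j + g l m) = coef2 t i j + coef2 t l m.
Proof. by rewrite pairingDr; congr (_ + _); apply: pairing_gen. Qed.

Lemma pairing_rel t i j l m c i' j' :
  pairing t (g i j + g l m + c *: g i' j') =
  coef2 t i j + coef2 t l m + c * coef2 t i' j'.
Proof.
rewrite (lin_rel (pairingDr t) (fun c => pairingZr c t)).
by congr (_ + _ + _ * _); apply: pairing_gen.
Qed.

Lemma pairing_diag t a b c : pairing t (diag_form a b c) =
  a * coef2 t i0 i0 + b * coef2 t i1 i1 + c * coef2 t i2 i2.
Proof.
rewrite (lin_comb3 (pairingDr t) (fun c => pairingZr c t)).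
by congr (_ * _ + _ * _ + _ * _); apply: pairing_gen.
Qed.

Lemma coef2_rel_u (Q : quad_rels k) i j l a b :
  coef2 (rel_u Q (x i) (x j) (x l)) a b =
  ((a == j) && (b == j))%:R
   - (uu_ww Q * ((a == i) && (b == i))%:R + uu_wu Q * ((a == i) && (b == j))%:R
      + uu_wv Q * ((a == i) && (b == l))%:R + uu_uv Q * ((a == j) && (b == l))%:R).
Proof.
rewrite rel_uE (lin_sub4 (phi := fun t => coef2 t a b)).
- by congr (_ - (_ * _ + _ * _ + _ * _ + _ * _)); apply: coef2M.
- by move=> s t; apply: coef2D.
- by move=> c t; apply: coef2Z.
Qed.

Lemma coef2_rel_v (Q : quad_rels k) i j l a b :
  coef2 (rel_v Q (x i) (x j) (x l)) a b =
  ((a == l) && (b == l))%:R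
   - (vv_ww Q * ((a == i) && (b == i))%:R + vv_wu Q * ((a == i) && (b == j))%:R
      + vv_wv Q * ((a == i) && (b == l))%:R).
Proof.
rewrite rel_vE (lin_sub3 (phi := fun t => coef2 t a b)).
- by congr (_ - (_ * _ + _ * _ + _ * _)); apply: coef2M.
- by move=> s t; apply: coef2D.
- by move=> c t; apply: coef2Z.
Qed.

Lemma homog_rel_u Q i j l : free_homog 2 (rel_u Q (x i) (x j) (x l)).
Proof.
rewrite rel_uE; apply: free_homogD; first exact: homog_genM.
apply: free_homogN; do 3![apply: free_homogD; last exact/free_homogZ/homog_genM].
exact/free_homogZ/homog_genM.
Qed.

Lemma homog_rel_v Q i j l : free_homog 2 (rel_v Q (x i) (x j) (x l)).
Proof.
rewrite rel_vE; apply: free_homogD; first exact: homog_genM.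
apply: free_homogN; do 2![apply: free_homogD; last exact/free_homogZ/homog_genM].
exact/free_homogZ/homog_genM.
Qed.

Lemma skew_sym e1 e2 a b c r :
  r \in diag_form a b c :: skew_rels e1 e2 -> symmetric2 r.
Proof.
rewrite !inE => /or4P[] /eqP->.
- by do 2?apply: symmetric2D; apply/symmetric2Z/symmetric2X.
- exact: symmetric2C.
- apply: symmetric2D; first exact: symmetric2C.
  exact/symmetric2Z/symmetric2X.
- apply: symmetric2D; first exact: symmetric2C.
  exact/symmetric2Z/symmetric2X.
Qed.

Lemma perp_skewP e1 e2 a b c t : perp (diag_form a b c :: skew_rels e1 e2) t <->
  free_homog 2 t /\
  [/\ a * coef2 t i0 i0 + b * coef2 t i1 i1 + c * coef2 t i2 i2 = 0,
      coef2 t i0 i1 + coef2 t i1 i0 = 0,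
      coef2 t i1 i2 + coef2 t i2 i1 + e1 * coef2 t i0 i0 = 0 &
      coef2 t i2 i0 + coef2 t i0 i2 + e2 * coef2 t i1 i1 = 0].
Proof.
split=> [[th tr]|[th [ta t1 t2 t3]]]; split=> //.
  have tS r : r \in diag_form a b c :: skew_rels e1 e2 -> pairing t r = 0 := tr r.
  have mem i : (i < 4)%N -> nth 0 (diag_form a b c :: skew_rels e1 e2) i \in
      diag_form a b c :: skew_rels e1 e2.
    by move=> i4; apply: (@mem_nth (freeAlg k 3)).
  have tf : pairing t (diag_form a b c) = 0 := tS _ (mem 0 isT).
  have t1 : pairing t (g i0 i1 + g i1 i0) = 0 := tS _ (mem 1 isT).
  have t2 : pairing t (g i1 i2 + g i2 i1 + e1 *: g i0 i0) = 0 := tS _ (mem 2 isT).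
  have t3 : pairing t (g i2 i0 + g i0 i2 + e2 *: g i1 i1) = 0 := tS _ (mem 3 isT).
  by rewrite pairing_diag in tf; rewrite pairing_pair in t1;
    rewrite pairing_rel in t2; rewrite pairing_rel in t3.
move=> r; rewrite -/(pairing t r) !inE => /or4P[] /eqP->.
- by rewrite pairing_diag.
- by rewrite pairing_pair.
- by rewrite pairing_rel.
- by rewrite pairing_rel.
Qed.

Section Presentations.
Variables (e1 e2 : k).
Local Notation X := ('X_i0 : mpoly 3 k).
Local Notation Y := ('X_i1 : mpoly 3 k).
Local Notation Z := ('X_i2 : mpoly 3 k).

(** For f = a x^2 + b y^2 + z^2 the dual has relations x^2 = e1 yz + a z^2 and
    y^2 = e2 xz + b z^2: here w = z, u = x, v = y. *)
Definition rels_z (a b : k) : quad_rels k := QuadRels a 0 e1 0 b e2 0.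

(** The list q generates the same ideal as the relations Q in the variables w,
    u, v, and consists of linear combinations of them. *)
Definition ideal_gens (Q : quad_rels k) (w u v : 'I_3) (q : seq (mpoly 3 k)) :=
  [/\ ideal (fun p => p \in q) (rel_u Q ('X_w : mpoly 3 k) 'X_u 'X_v),
      ideal (fun p => p \in q) (rel_v Q ('X_w : mpoly 3 k) 'X_u 'X_v) &
      forall p, p \in q -> exists c1 c2 : k,
        p = c1 *: rel_u Q ('X_w : mpoly 3 k) 'X_u 'X_v
            + c2 *: rel_v Q ('X_w : mpoly 3 k) 'X_u 'X_v].

(** The element f^! is represented by z^2. *)
Lemma presentation_z a b q : ideal_gens (rels_z a b) i2 i0 i1 q ->
  presentation (skew_rels e1 e2) (diag_form a b 1) (g i2 i2) q (rels_z a b)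
    i2 i0 i1.
Proof.
move=> [qu qv qr]; split=> //.
- by move=> i; case: (ord3P i) => ->; constructor.
- exact: skew_sym.
- apply/perp_skewP; split; first exact: homog_rel_u.
  by split; rewrite !coef2_rel_u /=; ring.
- apply/perp_skewP; split; first exact: homog_rel_v.
  by split; rewrite !coef2_rel_v /=; ring.
- move=> t /perp_skewP[_ [tf t1 t2 t3]].
  exists (coef2 t i0 i0), (coef2 t i1 i1); rewrite !sum3 /rel_u /rel_v /=.
  have E0 : coef2 t i2 i2 = - (a * coef2 t i0 i0 + b * coef2 t i1 i1).
    by move: tf; rewrite mul1r addrC => /eqP; rewrite addr_eq0 => /eqP.
  have E1 : coef2 t i0 i1 = - coef2 t i1 i0.
    by apply/eqP; rewrite -addr_eq0 t1.
  have E2 : coef2 t i1 i2 = - (e1 * coef2 t i0 i0) - coef2 t i2 i1.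
    by apply/eqP; rewrite eq_sym subr_eq eq_sym -addr_eq0 t2.
  have E3 : coef2 t i2 i0 = - (e2 * coef2 t i1 i1) - coef2 t i0 i2.
    by apply/eqP; rewrite eq_sym subr_eq eq_sym -addr_eq0 t3.
  rewrite E0 E1 E2 E3 -!mul_mpolyC; ring.
- split; first exact: homog_genM.
  move=> r; rewrite -/(pairing (g i2 i2) r) !inE => /or3P[] /eqP->.
  + by rewrite pairing_pair !coef2M addr0.
  + by rewrite pairing_rel !coef2M /= mulr0 !addr0.
  + by rewrite pairing_rel !coef2M /= mulr0 !addr0.
- by rewrite pairing_diag !coef2M /= !mulr0 !add0r mulr1 oner_eq0.
Qed.

(** For f = a x^2 + y^2 the dual has relations
    x^2 = e1 yz + a (y^2 - e2 xz) and z^2 = 0: here w = y, u = x, v = z. *)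
Definition rels_y (a : k) : quad_rels k := QuadRels a 0 e1 (- (a * e2)) 0 0 0.

(** The element f^! is represented by y^2 - e2 zx. *)
Lemma presentation_y a q : ideal_gens (rels_y a) i1 i0 i2 q ->
  presentation (skew_rels e1 e2) (diag_form a 1 0)
    (g i1 i1 - e2 *: g i2 i0) q (rels_y a) i1 i0 i2.
Proof.
move=> [qu qv qr]; split=> //.
- by move=> i; case: (ord3P i) => ->; constructor.
- exact: skew_sym.
- apply/perp_skewP; split; first exact: homog_rel_u.
  by split; rewrite !coef2_rel_u /=; ring.
- apply/perp_skewP; split; first exact: homog_rel_v.
  by split; rewrite !coef2_rel_v /=; ring.
- move=> t /perp_skewP[_ [tf t1 t2 t3]].
  exists (coef2 t i0 i0), (coef2 t i2 i2); rewrite !sum3 /rel_u /rel_v /=.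
  have E0 : coef2 t i1 i1 = - (a * coef2 t i0 i0).
    by move: tf; rewrite mul0r addr0 mul1r addrC => /eqP; rewrite addr_eq0 => /eqP.
  have E1 : coef2 t i0 i1 = - coef2 t i1 i0.
    by apply/eqP; rewrite -addr_eq0 t1.
  have E2 : coef2 t i1 i2 = - (e1 * coef2 t i0 i0) - coef2 t i2 i1.
    by apply/eqP; rewrite eq_sym subr_eq eq_sym -addr_eq0 t2.
  have E3 : coef2 t i2 i0 = - (e2 * coef2 t i1 i1) - coef2 t i0 i2.
    by apply/eqP; rewrite eq_sym subr_eq eq_sym -addr_eq0 t3.
  rewrite E3 E0 E1 E2 -!mul_mpolyC; ring.
- split.
    apply: free_homogD; first exact: homog_genM.
    exact/free_homogN/free_homogZ/homog_genM.
  move=> r; rewrite -/(pairing _ r) !inE => /or3P[] /eqP->;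
    rewrite pairingDl pairingNl pairingZl.
  + by rewrite !pairing_pair !coef2M /=; ring.
  + by rewrite !pairing_rel !coef2M /=; ring.
  + by rewrite !pairing_rel !coef2M /=; ring.
- rewrite pairingDl pairingNl pairingZl !pairing_diag !coef2M /=.
  by rewrite !(mulr0, mul0r, add0r, addr0) mulr1 subr0 oner_eq0.
Qed.

End Presentations.

(** For f = x^2 and e2 = 0 the dual has relations y^2 = z^2 = 0: here w = x,
    u = y, v = z. *)
Definition rels_x : quad_rels k := QuadRels 0 0 0 0 0 0 0.

(** The element f^! is represented by x^2 - e1 yz. *)
Lemma presentation_x e1 q : ideal_gens rels_x i0 i1 i2 q ->
  presentation (skew_rels e1 0) (diag_form 1 0 0)
    (g i0 i0 - e1 *: g i1 i2) q rels_x i0 i1 i2.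
Proof.
move=> [qu qv qr]; split=> //.
- by move=> i; case: (ord3P i) => ->; constructor.
- exact: skew_sym.
- apply/perp_skewP; split; first exact: homog_rel_u.
  by split; rewrite !coef2_rel_u /=; ring.
- apply/perp_skewP; split; first exact: homog_rel_v.
  by split; rewrite !coef2_rel_v /=; ring.
- move=> t /perp_skewP[_ [tf t1 t2 t3]].
  exists (coef2 t i1 i1), (coef2 t i2 i2); rewrite !sum3 /rel_u /rel_v /=.
  have E0 : coef2 t i0 i0 = 0 by move: tf; rewrite !mul0r !addr0 mul1r.
  have E1 : coef2 t i0 i1 = - coef2 t i1 i0.
    by apply/eqP; rewrite -addr_eq0 t1.
  have E2 : coef2 t i1 i2 = - (e1 * coef2 t i0 i0) - coef2 t i2 i1.
    by apply/eqP; rewrite eq_sym subr_eq eq_sym -addr_eq0 t2.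
  have E3 : coef2 t i2 i0 = - (0 * coef2 t i1 i1) - coef2 t i0 i2.
    by apply/eqP; rewrite eq_sym subr_eq eq_sym -addr_eq0 t3.
  rewrite E3 E1 E2 E0 -!mul_mpolyC; ring.
- split.
    apply: free_homogD; first exact: homog_genM.
    exact/free_homogN/free_homogZ/homog_genM.
  move=> r; rewrite -/(pairing _ r) !inE => /or3P[] /eqP->;
    rewrite pairingDl pairingNl pairingZl.
  + by rewrite !pairing_pair !coef2M /=; ring.
  + by rewrite !pairing_rel !coef2M /=; ring.
  + by rewrite !pairing_rel !coef2M /=; ring.
- rewrite pairingDl pairingNl pairingZl !pairing_diag !coef2M /=.
  by rewrite !(mulr0, mul0r, add0r, addr0) mulr1 subr0 oner_eq0.
Qed.

Lemma ideal_gens2 Q w u v (q1 q2 : mpoly 3 k) (a1 a2 b1 b2 c1 c2 d1 d2 : k) :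
  rel_u Q ('X_w : mpoly 3 k) 'X_u 'X_v = a1 *: q1 + a2 *: q2 ->
  rel_v Q ('X_w : mpoly 3 k) 'X_u 'X_v = b1 *: q1 + b2 *: q2 ->
  q1 = c1 *: rel_u Q ('X_w : mpoly 3 k) 'X_u 'X_v
       + c2 *: rel_v Q ('X_w : mpoly 3 k) 'X_u 'X_v ->
  q2 = d1 *: rel_u Q ('X_w : mpoly 3 k) 'X_u 'X_v
       + d2 *: rel_v Q ('X_w : mpoly 3 k) 'X_u 'X_v ->
  ideal_gens Q w u v [:: q1; q2].
Proof.
move=> ru rv q1E q2E.
have iq c1' c2' : ideal (fun p => p \in [:: q1; q2]) (c1' *: q1 + c2' *: q2).
  by apply: ideal_add; apply: ideal_scale; apply: ideal_gen; rewrite !inE eqxx ?orbT.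
split; first by rewrite ru.
  by rewrite rv.
by move=> p; rewrite !inE => /orP[] /eqP->; [exists c1, c2|exists d1, d2].
Qed.

Lemma quad_eval_gen2 (B : algType k) (h : 'I_3 -> B) i j :
  quad_eval h (g i j) = h i * h j.
Proof.
rewrite /quad_eval (bigD1 i) //= (bigD1 j) //= big1 => [|l lj]; last first.
  by rewrite coef2M (negPf lj) andbF scale0r.
rewrite big1 => [|l li]; last first.
  by rewrite big1 // => m _; rewrite coef2M (negPf li) scale0r.
by rewrite coef2M !eqxx scale1r !addr0.
Qed.

Lemma quad_evalB (B : algType k) (h : 'I_3 -> B) c s t :
  quad_eval h (s - c *: t) = quad_eval h s - c *: quad_eval h t.
Proof.
rewrite /quad_eval scaler_sumr -sumrB; apply: eq_bigr => i _.
rewrite scaler_sumr -sumrB; apply: eq_bigr => j _.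
by rewrite coef2D coef2N coef2Z scalerBl scalerA.
Qed.

End Relations.

(** * Coordinates in the target algebras *)

Section Targets.
Variable k : fieldType.

Lemma trunc_mulC m (a b : trunc k m) : a * b = b * a.
Proof. exact: (@qpoly_mulC k 'X^m a b). Qed.

Lemma prod_mulC (A B : algType k) :
  (forall a b : A, a * b = b * a) -> (forall a b : B, a * b = b * a) ->
  forall a b : (A * B)%type, a * b = b * a.
Proof. by move=> AC BC [a1 a2] [b1 b2]; congr (_, _). Qed.

Lemma base_mulC (a b : k^o) : a * b = b * a.
Proof. exact: (@mulrC k). Qed.

Lemma trunc_coords m : has_coords m.+1 (trunc k m.+1).
Proof.
exists (fun p : {poly %/ ('X^(m.+1) : {poly k})} =>
  \row_(i < m.+1) (p : {poly k})`_i); split=> [c a b|p p0].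
  by apply/rowP => i; rewrite !mxE coefD coefZ.
apply/npolyP => i; rewrite coef0.
have [im|im] := ltnP i m.+1.
  by have /rowP/(_ (Ordinal im)) := p0; rewrite !mxE.
apply: nth_default; apply: leq_trans im.
have sE : (size (mk_monic ('X^(m.+1) : {poly k}))).-1 = m.+1.
  by rewrite mk_monic_Xn size_polyXn.
by rewrite -[X in (_ <= X)%N]sE; apply: size_npoly.
Qed.

Lemma base_coords : has_coords 1 k^o.
Proof.
exists (fun c : k^o => \row_i (c : k)); split=> [c a b|c c0].
  by apply/rowP => i; rewrite !mxE.
by have /rowP/(_ 0) := c0; rewrite !mxE.
Qed.

Lemma prod_coords m n (A B : algType k) :
  has_coords m A -> has_coords n B -> has_coords (m + n) (A * B)%type.
Proof.
move=> [L [LP Linj]] [M [MP Minj]].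
exists (fun p => row_mx (L p.1) (M p.2)); split=> [c [a1 a2] [b1 b2]|[a b] ab] /=.
  by rewrite scale_row_mx add_row_mx -LP -MP.
have [a0 b0] : L a = 0 /\ M b = 0.
  by move: ab; rewrite -(row_mx0 k) => /eq_row_mx.
by rewrite (Linj _ a0) (Minj _ b0).
Qed.

(** The projection k[X] -> k[X]/(X^(m+1)) and its kernel. *)
Lemma trunc_proj m : exists i : {lrmorphism {poly k} -> trunc k m.+1},
  forall p, i p = 0 <-> forall j, (j <= m)%N -> p`_j = 0.
Proof.
have [c p q||p q|i iE] := @lrmorphism_of k {poly k} (trunc k m.+1)
  (in_qpoly ('X^(m.+1) : {poly k})).
- exact: linearP.
- exact: in_qpoly1.
- exact: in_qpolyM.
exists i => p; rewrite iE.
have vE : val (in_qpoly ('X^(m.+1) : {poly k}) p) = take_poly m.+1 p.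
  by rewrite /= mk_monic_Xn -Pdiv.RingMonic.take_poly_rmodp.
split=> [p0 j jm|p0].
  have := congr1 (fun q : {poly %/ ('X^(m.+1) : {poly k})} => (q : {poly k})`_j) p0.
  by rewrite vE coef_take_poly ltnS jm coef0.
apply: val_inj; rewrite vE; apply/polyP => j; rewrite coef_take_poly coef0 ltnS.
by case: ifP => // /p0.
Qed.

(** The combination r0 + r1 U + r2 V + r3 UV. *)
Definition comb (A : algType k) (U V : A) (r0 r1 r2 r3 : k) : A :=
  r0 *: 1 + r1 *: U + r2 *: V + r3 *: (U * V).

Lemma comb_hom (A B : algType k) (phi : {lrmorphism A -> B}) U V r0 r1 r2 r3 :
  phi (comb U V r0 r1 r2 r3) = comb (phi U) (phi V) r0 r1 r2 r3.
Proof. by rewrite lrmorph_comb4 lrmorphM lrmorph1. Qed.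

Lemma lin_free_comb (A : algType k) (U V : A) :
  (forall r0 r1 r2 r3, comb U V r0 r1 r2 r3 = 0 ->
     [/\ r0 = 0, r1 = 0, r2 = 0 & r3 = 0]) ->
  lin_free (basis_seq U V).
Proof.
move=> free r; rewrite basis_sum => /free[r0 r1 r2 r3]; apply/rowP => i; rewrite mxE.
case: i => [[|[|[|[|]]]]] // lti; [rewrite -[RHS]r0|rewrite -[RHS]r1|rewrite -[RHS]r2|
  rewrite -[RHS]r3]; congr (r _ _); exact: val_inj.
Qed.

Lemma comb_pair (A B : algType k) (U1 V1 : A) (U2 V2 : B) r0 r1 r2 r3 :
  comb ((U1, U2) : (A * B)%type) (V1, V2) r0 r1 r2 r3 = 0 ->
  comb U1 V1 r0 r1 r2 r3 = 0 /\ comb U2 V2 r0 r1 r2 r3 = 0.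
Proof. by case. Qed.

Lemma comb_base (u v : k) r0 r1 r2 r3 :
  comb (u : k^o) v r0 r1 r2 r3 = r0 + r1 * u + r2 * v + r3 * (u * v).
Proof. by rewrite /comb /GRing.scale /= mulr1. Qed.

Lemma rel_u_pair (Q : quad_rels k) (A B : algType k) (U1 V1 : A) (U2 V2 : B) :
  rel_u Q 1 U1 V1 = 0 -> rel_u Q 1 U2 V2 = 0 ->
  rel_u Q 1 ((U1, U2) : (A * B)%type) (V1, V2) = 0.
Proof. by move=> r1 r2; apply/pair_equal_spec. Qed.

Lemma rel_v_pair (Q : quad_rels k) (A B : algType k) (U1 V1 : A) (U2 V2 : B) :
  rel_v Q 1 U1 V1 = 0 -> rel_v Q 1 U2 V2 = 0 ->
  rel_v Q 1 ((U1, U2) : (A * B)%type) (V1, V2) = 0.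
Proof. by move=> r1 r2; apply/pair_equal_spec. Qed.

Lemma rel_u_base (Q : quad_rels k) (u v : k) : rel_u Q (1 : k^o) u v =
  u * u - (uu_ww Q + uu_wu Q * u + uu_wv Q * v + uu_uv Q * (u * v)).
Proof. by rewrite /rel_u /GRing.scale /= !mul1r mulr1. Qed.

Lemma rel_v_base (Q : quad_rels k) (u v : k) : rel_v Q (1 : k^o) u v =
  v * v - (vv_ww Q + vv_wu Q * u + vv_wv Q * v).
Proof. by rewrite /rel_v /GRing.scale /= !mul1r mulr1. Qed.

End Targets.

(** * From four-dimensional algebras to conics *)

Section Models.
Variable k : fieldType.

(** B has dimension four and is generated by the solution (U, V) of Q at w = 1:
    [cm_free] says that 1, U, V, UV are linearly independent. *)
Record conic_model (Q : quad_rels k) (B : algType k) (U V : B) : Prop :=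
    ConicModel {
  cm_C : forall a b : B, a * b = b * a;
  cm_u : rel_u Q 1 U V = 0;
  cm_v : rel_v Q 1 U V = 0;
  cm_coords : has_coords 4 B;
  cm_free : forall r0 r1 r2 r3, comb U V r0 r1 r2 r3 = 0 ->
     [/\ r0 = 0, r1 = 0, r2 = 0 & r3 = 0]
}.

Section Conclusions.
Hypothesis kinf : forall p : {poly k}, (forall l, l != 0 -> p.[l] = 0) -> p = 0.
Variables (e1 e2 a b : k) (q : seq (mpoly 3 k)) (B : algType k) (U V : B).

Lemma cm_basis Q : conic_model Q U V -> lin_basis (basis_seq U V).
Proof.
move=> cm; apply: coords_basis (cm_coords cm) _.
exact/lin_free_comb/(cm_free cm).
Qed.

(** With v^2 = 0 this inverts the value 1 - c UV of f^!. *)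
Lemma sqr0_unit Q (c : k) : vv_ww Q = 0 -> vv_wu Q = 0 -> vv_wv Q = 0 ->
  conic_model Q U V -> (1 - c *: (U * V)) * (1 + c *: (U * V)) = 1.
Proof.
move=> v1 v2 v3 [BC _ rv _ _].
have VV : V * V = 0.
  by move: rv; rewrite /rel_v v1 v2 v3 !scale0r !addr0 subr0.
rewrite mulrDr mulr1 mulrBl mul1r -scalerAl -scalerAr -(mulrA U) (mulrA V) (BC V).
by rewrite -(mulrA U) VV !mulr0 !scaler0 subr0 subrK.
Qed.

Lemma conic_z : ideal_gens (rels_z e1 e2 a b) i2 i0 i1 q ->
  conic_model (rels_z e1 e2 a b) U V ->
  qdual_is (diag_form a b 1 :: skew_rels e1 e2) q /\
  C_is (skew_rels e1 e2) (diag_form a b 1) B.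
Proof.
move=> /presentation_z pres cm.
pose h (i : 'I_3) : B := nth 0 [:: U; V; 1] i.
have md : model (gen2 k i2 i2) (rels_z e1 e2 a b) i2 i0 i1 h.
  case: (cm) => [BC ru rv _ _]; split=> //; first exact: cm_basis cm.
  by exists 1; rewrite quad_eval_gen2 !mulr1.
by split; [exact: quadratic_dual_is kinf pres md|exact: C_is_model kinf pres md].
Qed.

Lemma conic_y : ideal_gens (rels_y e1 e2 a) i1 i0 i2 q ->
  conic_model (rels_y e1 e2 a) U V ->
  qdual_is (diag_form a 1 0 :: skew_rels e1 e2) q /\
  C_is (skew_rels e1 e2) (diag_form a 1 0) B.
Proof.
move=> /presentation_y pres cm.
pose h (i : 'I_3) : B := nth 0 [:: U; 1; V] i.
have md : model (gen2 k i1 i1 - e2 *: gen2 k i2 i0) (rels_y e1 e2 a) i1 i0 i2 h.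
  case: (cm) => [BC ru rv _ _]; split=> //; first exact: cm_basis cm.
  exists (1 + e2 *: (U * V)); rewrite quad_evalB !quad_eval_gen2 mulr1.
  by rewrite (BC (h i2)); apply: sqr0_unit cm.
by split; [exact: quadratic_dual_is kinf pres md|exact: C_is_model kinf pres md].
Qed.

Lemma conic_x : ideal_gens (rels_x k) i0 i1 i2 q ->
  conic_model (rels_x k) U V ->
  qdual_is (diag_form 1 0 0 :: skew_rels e1 0) q /\
  C_is (skew_rels e1 0) (diag_form 1 0 0) B.
Proof.
move=> /(presentation_x e1) pres cm.
pose h (i : 'I_3) : B := nth 0 [:: 1; U; V] i.
have md : model (gen2 k i0 i0 - e1 *: gen2 k i1 i2) (rels_x k) i0 i1 i2 h.
  case: (cm) => [BC ru rv _ _]; split=> //; first exact: cm_basis cm.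
  exists (1 + e1 *: (U * V)); rewrite quad_evalB !quad_eval_gen2 mulr1.
  exact: sqr0_unit cm.
by split; [exact: quadratic_dual_is kinf pres md|exact: C_is_model kinf pres md].
Qed.

End Conclusions.

Lemma coef_hd (c : k) (p : {poly k}) : (c%:P + 'X * p)`_0 = c.
Proof. by rewrite coefD coefC coefXM addr0. Qed.

Lemma coef_tl (c : k) (p : {poly k}) j : (c%:P + 'X * p)`_j.+1 = p`_j.
Proof. by rewrite coefD coefC coefXM add0r. Qed.

Definition coef_low := (coef_hd, coef_tl).

Section PolyRels.
Variables (Q : quad_rels k) (A : algType k) (phi : {lrmorphism {poly k} -> A}).

Lemma rel_u_poly P R : phi (rel_u Q 1 P R) = 0 -> rel_u Q 1 (phi P) (phi R) = 0.
Proof. by rewrite rel_u_hom lrmorph1. Qed.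

Lemma rel_v_poly P R : phi (rel_v Q 1 P R) = 0 -> rel_v Q 1 (phi P) (phi R) = 0.
Proof. by rewrite rel_v_hom lrmorph1. Qed.

End PolyRels.

(** The point (u0 + u1 e, v0 + v1 e) over the dual numbers k[e]/(e^2): when it
    solves Q, and the two linear forms in r0, ..., r3 that vanish where the
    combination of 1, U, V, UV does. *)
Lemma dual_point (u0 u1 v0 v1 : k) : exists U V : trunc k 2, [/\
  forall Q, u0 * u0 - (uu_ww Q + uu_wu Q * u0 + uu_wv Q * v0 + uu_uv Q * (u0 * v0)) = 0 ->
     u0 * u1 + u0 * u1 - (uu_wu Q * u1 + uu_wv Q * v1 + uu_uv Q * (u0 * v1 + u1 * v0)) = 0 ->
     rel_u Q 1 U V = 0,
  forall Q, v0 * v0 - (vv_ww Q + vv_wu Q * u0 + vv_wv Q * v0) = 0 ->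
     v0 * v1 + v0 * v1 - (vv_wu Q * u1 + vv_wv Q * v1) = 0 ->
     rel_v Q 1 U V = 0 &
  forall r0 r1 r2 r3, comb U V r0 r1 r2 r3 = 0 ->
     r0 + r1 * u0 + r2 * v0 + r3 * (u0 * v0) = 0 /\
     r1 * u1 + r2 * v1 + r3 * (u0 * v1 + u1 * v0) = 0].
Proof.
have [i iP] := trunc_proj k 1.
pose P := u0%:P + 'X * (u1%:P + 'X * 0); pose R := v0%:P + 'X * (v1%:P + 'X * 0).
exists (i P), (i R); split=> [Q c0 c1|Q c0 c1|r0 r1 r2 r3].
- apply/rel_u_poly/iP.
  have -> : rel_u Q 1 P R =
    (u0 * u0 - (uu_ww Q + uu_wu Q * u0 + uu_wv Q * v0 + uu_uv Q * (u0 * v0)))%:P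
    + 'X * ((u0 * u1 + u0 * u1 - (uu_wu Q * u1 + uu_wv Q * v1
               + uu_uv Q * (u0 * v1 + u1 * v0)))%:P
            + 'X * (u1 * u1 - uu_uv Q * (u1 * v1))%:P).
    by rewrite /rel_u /P /R -!mul_polyC; ring.
  by move=> [|[|//]] _; rewrite !coef_low.
- apply/rel_v_poly/iP.
  have -> : rel_v Q 1 P R =
    (v0 * v0 - (vv_ww Q + vv_wu Q * u0 + vv_wv Q * v0))%:P
    + 'X * ((v0 * v1 + v0 * v1 - (vv_wu Q * u1 + vv_wv Q * v1))%:P
            + 'X * (v1 * v1)%:P).
    by rewrite /rel_v /P /R -!mul_polyC; ring.
  by move=> [|[|//]] _; rewrite !coef_low.
rewrite -comb_hom => /iP.
have -> : comb P R r0 r1 r2 r3 =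
    (r0 + r1 * u0 + r2 * v0 + r3 * (u0 * v0))%:P
    + 'X * ((r1 * u1 + r2 * v1 + r3 * (u0 * v1 + u1 * v0))%:P
            + 'X * (r3 * (u1 * v1))%:P).
  by rewrite /comb /P /R -!mul_polyC; ring.
by move=> c; have := c 0 isT; have := c 1 isT; rewrite !coef_low.
Qed.

End Models.

(** * Points of the pencils in the target algebras *)

Section ConcreteModels.
Variable k : fieldType.

Lemma mulf_id0 (c x : k) : c != 0 -> c * x = 0 -> x = 0.
Proof. by move=> c0 /eqP; rewrite mulf_eq0 (negPf c0) => /eqP. Qed.

Section Char.
Hypothesis two : (2 : k) != 0.

Lemma sum_diff0 (x y : k) : x + y = 0 -> x - y = 0 -> x = 0 /\ y = 0.
Proof.
move=> xy xy'; split; apply: (mulf_id0 two).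
  by rewrite -[RHS](addr0 0) -{1}xy -xy'; ring.
by rewrite -[RHS](subr0 0) -{1}xy -xy'; ring.
Qed.

(** Modulo V, which squares to zero, U is a square root of r^2; the roots r and
    - r lift to r + s(r) e and - r + s(- r) e with V = e. *)
Lemma model_y_two (e1 e2 r : k) : r != 0 ->
  exists U V, @conic_model k (rels_y e1 e2 (r ^+ 2)) (trunc k 2 * trunc k 2)%type U V.
Proof.
move=> r0; pose s r := (e1 - r ^+ 2 * e2 * r) / (2 * r).
have sE t : t != 0 -> t ^+ 2 = r ^+ 2 -> 2 * t * s t = e1 - r ^+ 2 * e2 * t.
  by move=> t0 tr; rewrite /s tr mulrC mulfVK // mulf_neq0.
have [U1 [V1 [ru1 rv1 c1]]] := dual_point r (s r) 0 1.
have [U2 [V2 [ru2 rv2 c2]]] := dual_point (- r) (s (- r)) 0 1.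
exists (U1, U2), (V1, V2); split.
- exact/prod_mulC/trunc_mulC/trunc_mulC.
- apply: rel_u_pair; [apply: ru1|apply: ru2] => /=; try ring.
    have /eqP := sE r r0 erefl; rewrite -subr_eq0 => /eqP E.
    by rewrite -[RHS]E; ring.
  have := sE (- r); rewrite oppr_eq0 sqrrN => /(_ r0 erefl) /eqP.
  by rewrite -subr_eq0 => /eqP E; rewrite -[RHS]E; ring.
- by apply: rel_v_pair; [apply: rv1|apply: rv2] => /=; ring.
- exact: (prod_coords (trunc_coords k 1) (trunc_coords k 1)).
- move=> a0 a1 a2 a3 /comb_pair[/c1[p1 q1] /c2[p2 q2]].
  have [a00 /eqP] : a0 = 0 /\ a1 * r = 0.
    by apply: sum_diff0; [rewrite -[RHS]p1|rewrite -[RHS]p2]; ring.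
  rewrite mulf_eq0 (negPf r0) orbF => /eqP a10.
  have [a20 /eqP] : a2 = 0 /\ a3 * r = 0.
    by apply: sum_diff0; [rewrite -[RHS]q1|rewrite -[RHS]q2]; rewrite a10; ring.
  by rewrite mulf_eq0 (negPf r0) orbF => /eqP a30.
Qed.

(** The four points (u, v) = (p, 1), (- p, 1), (m, -1), (- m, -1). *)
Lemma model_z_points (e a p m : k) : p ^+ 2 = a + e -> m ^+ 2 = a - e ->
  p != 0 -> m != 0 -> exists U V, @conic_model k (rels_z e 0 a 1) (k4 k) U V.
Proof.
move=> pE mE p0 m0.
have ru u v : u ^+ 2 = a + e * v -> rel_u (rels_z e 0 a 1) (1 : k^o) u v = 0.
  by rewrite rel_u_base /= -expr2 => ->; ring.
have rv u v : v ^+ 2 = 1 -> rel_v (rels_z e 0 a 1) (1 : k^o) u v = 0.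
  by rewrite rel_v_base /= -expr2 => ->; ring.
exists (((p : k^o, - p : k^o), m : k^o), - m : k^o),
       (((1 : k^o, 1 : k^o), -1 : k^o), -1 : k^o); split.
- by do 3?[apply: prod_mulC; last exact: base_mulC]; apply: base_mulC.
- by apply: rel_u_pair; [apply: rel_u_pair; [apply: rel_u_pair|]|];
    apply: ru; rewrite ?sqrrN ?pE ?mE ?mulr1 ?mulrN1.
- by apply: rel_v_pair; [apply: rel_v_pair; [apply: rel_v_pair|]|];
    apply: rv; rewrite ?sqrrN expr1n.
- have c1 := base_coords k; have c2 := prod_coords c1 c1.
  exact: (prod_coords (prod_coords c2 c1) c1).
- move=> a0 a1 a2 a3 /comb_pair[/comb_pair[/comb_pair[]]].
  rewrite !comb_base => c1 c2 c3 c4.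
  have [x1 /eqP] : a0 + a2 = 0 /\ p * (a1 + a3) = 0.
    by apply: sum_diff0; [rewrite -[RHS]c1|rewrite -[RHS]c2]; ring.
  rewrite mulf_eq0 (negPf p0) => /eqP x2.
  have [x3 /eqP] : a0 - a2 = 0 /\ m * (a1 - a3) = 0.
    by apply: sum_diff0; [rewrite -[RHS]c3|rewrite -[RHS]c4]; ring.
  rewrite mulf_eq0 (negPf m0) => /eqP x4.
  by have [] := sum_diff0 x1 x3; have [] := sum_diff0 x2 x4.
Qed.

(** The double point (e, s) and the points (r, - s), (- r, - s), for s = 1 or
    s = -1. *)
Lemma model_z_double (s r : k) : s ^+ 2 = 1 -> r ^+ 2 = - 2 * s -> r != 0 ->
  exists U V, @conic_model k (rels_z 1 0 (- s) 1) (trunc k 2 * k2 k)%type U V.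
Proof.
move=> sE rE r0.
have [U1 [V1 [ru1 rv1 c1]]] := dual_point 0 1 s 0.
have s0 : s != 0 by rewrite -sqrf_eq0 sE oner_eq0.
exists (U1, (r : k^o, - r : k^o)), (V1, (- s : k^o, - s : k^o)); split.
- apply: prod_mulC; first exact: trunc_mulC.
  by apply: prod_mulC; apply: base_mulC.
- apply: rel_u_pair; first by apply: ru1 => /=; ring.
  by apply: rel_u_pair; rewrite rel_u_base /= ?mulrNN -expr2 rE; ring.
- apply: rel_v_pair; first by apply: rv1 => /=; rewrite -?expr2 ?sE; ring.
  by apply: rel_v_pair; rewrite rel_v_base /= ?mulrNN -expr2 sE; ring.
- apply: (prod_coords (trunc_coords k 1)).
  exact: (prod_coords (base_coords k) (base_coords k)).
- move=> a0 a1 a2 a3 /comb_pair[/c1[p1 q1] /comb_pair[]].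
  rewrite !comb_base => c2 c3.
  have [x1 /eqP] : a0 - a2 * s = 0 /\ r * (a1 - a3 * s) = 0.
    by apply: sum_diff0; [rewrite -[RHS]c2|rewrite -[RHS]c3]; ring.
  rewrite mulf_eq0 (negPf r0) => /eqP x2.
  have y1 : a0 + a2 * s = 0 by rewrite -[RHS]p1; ring.
  have y2 : a1 + a3 * s = 0 by rewrite -[RHS]q1; ring.
  have [-> /eqP] := sum_diff0 y1 x1; have [-> /eqP] := sum_diff0 y2 x2.
  by rewrite !mulf_eq0 (negPf s0) !orbF => /eqP -> /eqP ->.
Qed.

End Char.

(** U is the class of X and V = U^2. *)
Lemma model_y_quartic (e2 : k) :
  exists U V, @conic_model k (rels_y 1 e2 0) (trunc k 4) U V.
Proof.
have [i iP] := trunc_proj k 3.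
exists (i 'X), (i ('X ^+ 2)); split.
- exact: trunc_mulC.
- apply: rel_u_poly; rewrite [rel_u _ _ _ _](_ : _ = 0) ?lrmorph0 //.
  by rewrite /rel_u /= -!mul_polyC; ring.
- apply/rel_v_poly/iP; rewrite [rel_v _ _ _ _](_ : _ = 'X^4) => [j j3|].
    by rewrite coefXn; case: j j3 => [|[|[|[|]]]].
  by rewrite /rel_v /= -!mul_polyC; ring.
- exact: (trunc_coords k 3).
move=> a0 a1 a2 a3; rewrite -comb_hom => /iP.
have -> : comb 'X ('X ^+ 2) a0 a1 a2 a3 =
    a0%:P + 'X * (a1%:P + 'X * (a2%:P + 'X * (a3%:P + 'X * 0))).
  by rewrite /comb -!mul_polyC; ring.
move=> c; have := c 0 isT; have := c 1 isT; have := c 2 isT; have := c 3 isT.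
by rewrite !coef_low.
Qed.

Section Quartic.
Variables (a b : k).

(** The quartic whose roots are the values of V when U^2 = V + a and
    V^2 = U + b; each root t gives the point (t^2 - b, t). *)
Definition quartic_at (t : k) : k := (t ^+ 2 - b) ^+ 2 - t - a.

Lemma quartic_rel_u t : quartic_at t = 0 ->
  rel_u (rels_z 1 1 a b) (1 : k^o) (t ^+ 2 - b : k) t = 0.
Proof. by move=> t0; rewrite -[RHS]t0 rel_u_base /quartic_at /=; ring. Qed.

Lemma quartic_rel_v t : rel_v (rels_z 1 1 a b) (1 : k^o) (t ^+ 2 - b : k) t = 0.
Proof. by rewrite rel_v_base /=; ring. Qed.

Lemma quartic_comb t a0 a1 a2 a3 :
  comb (t ^+ 2 - b : k^o) t a0 a1 a2 a3 =
  (a0 - b * a1) + (a2 - b * a3) * t + a1 * t ^+ 2 + a3 * t ^+ 3.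
Proof. by rewrite comb_base; ring. Qed.

(** A combination of 1, U, V, UV is a polynomial of degree at most three in V;
    here it has four roots. *)
Lemma model_quartic_simple t1 t2 t3 t4 : uniq [:: t1; t2; t3; t4] ->
  (forall t, t \in [:: t1; t2; t3; t4] -> quartic_at t = 0) ->
  exists U V, @conic_model k (rels_z 1 1 a b) (k4 k) U V.
Proof.
move=> tu t0; pose u t : k^o := t ^+ 2 - b.
exists (((u t1, u t2), u t3), u t4),
       (((t1 : k^o, t2 : k^o), t3 : k^o), t4 : k^o); split.
- by do 3?[apply: prod_mulC; last exact: base_mulC]; apply: base_mulC.
- by apply: rel_u_pair; [apply: rel_u_pair; [apply: rel_u_pair|]|];
    apply: quartic_rel_u; apply: t0; rewrite !inE eqxx ?orbT.
- by apply: rel_v_pair; [apply: rel_v_pair; [apply: rel_v_pair|]|];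
    apply: quartic_rel_v.
- have c1 := base_coords k; have c2 := prod_coords c1 c1.
  exact: (prod_coords (prod_coords c2 c1) c1).
- move=> a0 a1 a2 a3 /comb_pair[/comb_pair[/comb_pair[]]].
  rewrite !quartic_comb => c1 c2 c3 c4.
  pose p := \poly_(i < 4) [:: a0 - b * a1; a2 - b * a3; a1; a3]`_i.
  have pE t : p.[t] =
      (a0 - b * a1) + (a2 - b * a3) * t + a1 * t ^+ 2 + a3 * t ^+ 3.
    by rewrite horner_poly !big_ord_recr big_ord0 /= expr0 expr1 mulr1 add0r.
  have p0 : p = 0.
    apply: (roots_geq_poly_eq0 (rs := [:: t1; t2; t3; t4])) => //.
      by rewrite /= /root !pE c1 c2 c3 c4 !eqxx.
    exact: size_poly.
  have pc i : (i < 4)%N -> [:: a0 - b * a1; a2 - b * a3; a1; a3]`_i = 0.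
    by move=> i4; have := coef_poly 4 (fun i => [:: a0 - b * a1; a2 - b * a3; a1; a3]`_i) i;
      rewrite -/p p0 coef0 i4 => <-.
  have /= := pc 2 isT; have /= := pc 3 isT; have /= := pc 0 isT; have /= := pc 1 isT.
  by move=> E1 E0 a30 a10; move: E1 E0; rewrite a30 a10 !mulr0 !subr0 => -> ->.
Qed.

Lemma model_quartic_double r t1 t2 : quartic_at r = 0 ->
  4 * r ^+ 3 - 4 * b * r - 1 = 0 -> quartic_at t1 = 0 -> quartic_at t2 = 0 ->
  t1 != r -> t2 != r -> t1 != t2 ->
  exists U V, @conic_model k (rels_z 1 1 a b) (trunc k 2 * k2 k)%type U V.
Proof.
move=> r0 dr0 t10 t20 t1r t2r t12; pose u t : k^o := t ^+ 2 - b.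
have [U [V [ru rv c]]] := dual_point (r ^+ 2 - b) (2 * r) r 1.
exists (U, (u t1, u t2)), (V, (t1 : k^o, t2 : k^o)); split.
- apply: prod_mulC; first exact: trunc_mulC.
  by apply: prod_mulC; apply: base_mulC.
- apply: rel_u_pair.
    by apply: ru => /=; [rewrite -[RHS]r0 /quartic_at|rewrite -[RHS]dr0]; ring.
  by apply: rel_u_pair; apply: quartic_rel_u.
- apply: rel_v_pair; first by apply: rv => /=; ring.
  by apply: rel_v_pair; apply: quartic_rel_v.
- apply: (prod_coords (trunc_coords k 1)).
  exact: (prod_coords (base_coords k) (base_coords k)).
- move=> a0 a1 a2 a3 /comb_pair[/c[p q] /comb_pair[]].
  rewrite !quartic_comb => c1 c2.
  have lin t : t != r -> (a0 - b * a1) + (a2 - b * a3) * t + a1 * t ^+ 2 + a3 * t ^+ 3 = 0 ->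
      a1 + 2 * a3 * r + a3 * t = 0.
    rewrite -subr_eq0 => tr pt; apply: (mulf_id0 (expf_neq0 2 tr)).
    transitivity (((a0 - b * a1) + (a2 - b * a3) * t + a1 * t ^+ 2 + a3 * t ^+ 3)
      - (a0 + a1 * (r ^+ 2 - b) + a2 * r + a3 * ((r ^+ 2 - b) * r))
      - (t - r) * (a1 * (2 * r) + a2 * 1 + a3 * ((r ^+ 2 - b) * 1 + 2 * r * r))).
      by ring.
    by rewrite pt p q mulr0 !subr0.
  have l1 := lin t1 t1r c1; have l2 := lin t2 t2r c2.
  have a30 : a3 = 0.
    rewrite -subr_eq0 in t12; apply: (mulf_id0 t12).
    by rewrite -[RHS](subr0 0) -{1}l1 -l2; ring.
  have a10 : a1 = 0 by move: l1; rewrite a30 mulr0 !mul0r !addr0.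
  move: q p; rewrite a30 a10 !mul0r add0r addr0 mulr1 => ->.
  by rewrite !mul0r !addr0 => ->.
Qed.

(** With b = 3 r^2 the second derivative vanishes at r as well; the roots sum to
    zero, so the fourth one is - 3 r. On the first factor V = r + X. *)
Lemma model_quartic_triple r : quartic_at r = 0 -> 2 != 0 :> k -> r != 0 ->
  4 * r ^+ 3 - 4 * b * r - 1 = 0 -> b = 3 * r ^+ 2 ->
  exists U V, @conic_model k (rels_z 1 1 a b) (trunc k 3 * k^o)%type U V.
Proof.
move=> r0 two rn0 dr0 bE; pose t := -3 * r.
have t0 : quartic_at t = 0.
  rewrite -[RHS](addr0 0) -{1}r0 -[in RHS](mulr0 (- 4 * r)) -[in RHS]dr0.
  by rewrite /quartic_at /t bE; ring.
have [i iP] := trunc_proj k 2.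
pose R := r%:P + 'X; pose P := R ^+ 2 - b%:P.
exists (i P, (t ^+ 2 - b : k^o)), (i R, t : k^o); split.
- by apply: prod_mulC; [apply: trunc_mulC|apply: base_mulC].
- apply: rel_u_pair; last exact: quartic_rel_u.
  apply/rel_u_poly/iP.
  have -> : rel_u (rels_z 1 1 a b) 1 P R = (quartic_at r)%:P +
      'X * ((4 * r ^+ 3 - 4 * b * r - 1)%:P +
      'X * ((2 * (3 * r ^+ 2 - b))%:P + 'X * ((4 * r)%:P + 'X))).
    by rewrite /rel_u /quartic_at /P /R /= -!mul_polyC; ring.
  by move=> [|[|[|//]]] _; rewrite !coef_low // bE subrr mulr0.
- apply: rel_v_pair; last exact: quartic_rel_v.
  apply/rel_v_poly; rewrite [rel_v _ _ _ _](_ : _ = 0) ?lrmorph0 //.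
  by rewrite /rel_v /P /= -!mul_polyC; ring.
- exact: (prod_coords (trunc_coords k 2) (base_coords k)).
- move=> a0 a1 a2 a3 /comb_pair[]; rewrite -comb_hom quartic_comb => /iP c ct.
  move: c; have -> : comb P R a0 a1 a2 a3 =
      ((a0 - b * a1) + (a2 - b * a3) * r + a1 * r ^+ 2 + a3 * r ^+ 3)%:P +
      'X * (((a2 - b * a3) + 2 * a1 * r + 3 * a3 * r ^+ 2)%:P +
      'X * ((a1 + 3 * a3 * r)%:P + 'X * a3%:P)).
    by rewrite /comb /P /R -!mul_polyC; ring.
  move=> c; have := c 0 isT; have := c 1 isT; have := c 2 isT.
  rewrite !coef_low => {}c c1 c0.
  have a30 : a3 = 0.
    have d0 : (t - r) ^+ 3 != 0.
      apply: expf_neq0; rewrite (_ : t - r = - (2 * 2 * r)); last by rewrite /t; ring.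
      by rewrite oppr_eq0 !mulf_neq0.
    apply: (mulf_id0 d0).
    transitivity (((a0 - b * a1) + (a2 - b * a3) * t + a1 * t ^+ 2 + a3 * t ^+ 3)
      - ((a0 - b * a1) + (a2 - b * a3) * r + a1 * r ^+ 2 + a3 * r ^+ 3)
      - (t - r) * ((a2 - b * a3) + 2 * a1 * r + 3 * a3 * r ^+ 2)
      - (t - r) ^+ 2 * (a1 + 3 * a3 * r)); first by ring.
    by rewrite ct c0 c1 c !mulr0 !subr0.
  have a10 : a1 = 0 by move: c; rewrite a30 mulr0 mul0r addr0.
  move: c1 c0; rewrite a30 a10 !mulr0 !mul0r !subr0 !addr0 => ->.
  by rewrite mul0r !addr0 => ->.
Qed.

End Quartic.

End ConcreteModels.

(** * The algebra k[u,v]/(u^2,v^2) and fields of characteristic zero *)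

Section TruncUV.
Variable k : fieldType.
Local Notation pi := (quot_pi (@uv_squares_proper k)).
Local Notation X0 := ('X_(ord0 : 'I_2) : mpoly 2 k).
Local Notation X1 := ('X_(ord_max : 'I_2) : mpoly 2 k).

(** The coefficients of 1, u, v, uv vanish on the ideal (u^2, v^2). *)
Lemma ideal_uv_coef (p : mpoly 2 k) (m : 'X_{1..2}) :
  ideal (fun p => p \in uv_squares k) p ->
  (m ord0 <= 1)%N -> (m ord_max <= 1)%N -> mcoeff m p = 0.
Proof.
move=> ip; move: m; elim: ip => {p} [p pq||p q _ hp _ hq|c p _ hp|p c _ hp] m m0 m1.
- move: pq; rewrite !inE => /orP[] /eqP->; rewrite mpolyXn mcoeffX; case: eqP => // mE;
    by move: m0 m1; rewrite -mE !mulmnE !mnm1E.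
- exact: mcoeff0.
- by rewrite mcoeffD hp ?hq ?addr0.
- rewrite mcoeffM big1 // => -[m' m''] /= /eqP mE.
  have mi i : (m'' i <= m i)%N.
    by have := congr1 (fun z : 'X_{1..2} => z i) mE; rewrite mnmDE => ->; apply: leq_addl.
  by rewrite hp ?mulr0 //; [apply: leq_trans m0|apply: leq_trans m1].
- rewrite mcoeffM big1 // => -[m' m''] /= /eqP mE.
  have mi i : (m' i <= m i)%N.
    by have := congr1 (fun z : 'X_{1..2} => z i) mE; rewrite mnmDE => ->; apply: leq_addr.
  by rewrite hp ?mul0r //; [apply: leq_trans m0|apply: leq_trans m1].
Qed.

Lemma model_x_uv : conic_model (rels_x k) (pi X0) (pi X1).
Proof.
have [p pE] := quot_pi_hom (@uv_squares_proper k).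
rewrite -!pE.
have sq0 (q : mpoly 2 k) : q \in uv_squares k -> p q = 0.
  by move=> qs; rewrite pE; apply/quot_piP; rewrite subr0; apply: ideal_gen.
have x00 : p X0 * p X0 = 0.
  by rewrite -lrmorphM -expr2 sq0 // inE eqxx.
have x11 : p X1 * p X1 = 0.
  by rewrite -lrmorphM -expr2 sq0 // !inE eqxx orbT.
have BC (a b : trunc_uv k) : a * b = b * a.
  elim/quot_ind: a => a; elim/quot_ind: b => b.
  by rewrite -!pE -!lrmorphM mulrC.
have free r0 r1 r2 r3 : comb (p X0) (p X1) r0 r1 r2 r3 = 0 ->
    [/\ r0 = 0, r1 = 0, r2 = 0 & r3 = 0].
  rewrite -comb_hom pE => /quot_piP; rewrite subr0 => /ideal_uv_coef c.
  have cE m : mcoeff m (comb X0 X1 r0 r1 r2 r3) =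
      r0 * (m == 0%MM)%:R + r1 * (U_(ord0) == m)%MM%:R
      + r2 * (U_(ord_max) == m)%MM%:R + r3 * (U_(ord0) + U_(ord_max) == m)%MM%:R.
    rewrite /comb !mcoeffD !mcoeffZ mcoeff1 !mcoeffX.
    by rewrite -mpolyXD mcoeffX.
  have ne (m m' : 'X_{1..2}) : mdeg m != mdeg m' -> (m == m') = false.
    by apply: contraNF => /eqP->.
  have e0 := c 0%MM; rewrite cE !mnm0E eqxx !ne ?mdegD ?mdeg1 ?mdeg0 // in e0.
  have e1 := c U_(ord0)%MM; rewrite cE !mnm1E !eqxx eq_mnm1 !ne ?mdegD ?mdeg1 ?mdeg0 // in e1.
  have e2 := c U_(ord_max)%MM; rewrite cE !mnm1E !eqxx eq_mnm1 !ne ?mdegD ?mdeg1 ?mdeg0 // in e2.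
  have e3 := c (U_(ord0) + U_(ord_max))%MM.
  rewrite cE !mnmDE !mnm1E !eqxx !ne ?mdegD ?mdeg1 ?mdeg0 // in e3.
  move: (e0 isT isT) (e1 isT isT) (e2 isT isT) (e3 isT isT).
  by rewrite /= !mulr0 !mulr1 !addr0 !add0r.
split=> //.
- by rewrite /rel_u /= x00 !scale0r !addr0 subr0.
- by rewrite /rel_v /= x11 !scale0r !addr0 subr0.
apply: (basis_coords (e := basis_seq (p X0) (p X1))); split.
  exact: lin_free_comb.
suff span b : exists r0 r1 r2 r3, b = comb (p X0) (p X1) r0 r1 r2 r3.
  move=> b; have [r0 [r1 [r2 [r3 ->]]]] := span b.
  by exists (\row_(i < 4) [:: r0; r1; r2; r3]`_i); rewrite basis_sum !mxE.
elim/quot_ind: b => b; rewrite -pE; elim/mpoly_gen_ind: b => [|a b|c a|i a].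
- by exists 1, 0, 0, 0; rewrite lrmorph1 /comb !scale0r !addr0 scale1r.
- move=> [r0 [r1 [r2 [r3 aE]]]] [s0 [s1 [s2 [s3 bE]]]].
  exists (r0 + s0), (r1 + s1), (r2 + s2), (r3 + s3); rewrite lrmorphD aE bE /comb.
  by rewrite !scalerDl; do 2![rewrite addrACA; congr (_ + _)]; rewrite addrACA.
- move=> [r0 [r1 [r2 [r3 aE]]]]; exists (c * r0), (c * r1), (c * r2), (c * r3).
  by rewrite lrmorphZ aE /comb !scalerDr !scalerA.
move=> [r0 [r1 [r2 [r3 aE]]]]; rewrite lrmorphM aE.
have [->|->] : i = ord0 \/ i = ord_max.
  by case: i => [[|[|]]] // lti; [left|right]; apply: val_inj.
- exists 0, r0, 0, r2; rewrite /comb !mulrDr -!scalerAr mulr1 mulrA x00 mul0r.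
  by rewrite !scaler0 !addr0 !scale0r add0r addr0.
exists 0, 0, r0, r1; rewrite /comb !mulrDr -!scalerAr mulr1 mulrA (BC (p X1) (p X0)).
by rewrite -mulrA x11 mulr0 !scaler0 !addr0 !scale0r !add0r addrC.
Qed.

End TruncUV.

Lemma char0_natr_neq0 (k : fieldType) : [pchar k] =i pred0 ->
  forall n, (n.+1%:R : k) != 0.
Proof. by move=> /pcharf0P k0 n; rewrite k0. Qed.

Lemma char0_poly_eq0 (k : fieldType) : [pchar k] =i pred0 ->
  forall p : {poly k}, (forall l, l != 0 -> p.[l] = 0) -> p = 0.
Proof.
move=> char0 p p0; have nz := char0_natr_neq0 char0.
apply: (roots_geq_poly_eq0 (rs := [seq (i.+1%:R : k) | i <- iota 0 (size p)])).
- by apply/allP => _ /mapP[i _ ->]; apply/eqP/p0.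
- rewrite map_inj_uniq ?iota_uniq // => i j /eqP.
  wlog ij : i j / (i <= j)%N.
    by move=> w; case/orP: (leq_total i j) => [/w//|/w w'] /eqP/esym/eqP/w'/esym.
  rewrite eq_sym -subr_eq0 -natrB // subSS.
  case E: (j - i)%N => [|d]; last by rewrite (negPf (nz d)).
  by move=> _; apply/eqP; rewrite eqn_leq ij -subn_eq0 E.
- by rewrite size_map size_iota.
Qed.

Lemma sqrt_exists (k : closedFieldType) (a : k) : exists r, r ^+ 2 = a.
Proof.
have /closed_rootP[r] : size ('X^2 - a%:P) != 1.
  by rewrite size_XnsubC.
by rewrite /root !hornerE subr_eq0 => /eqP ra; exists r.
Qed.

(** * The discriminant of the quartic *)

Section SparseDet.
Variable R : comNzRingType.

(** A sparse matrix is a list of rows, in which None stands for a zero entry;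
    rows are implicitly continued by zeros. *)
Definition sparse := seq (seq (option R)).

Definition entry (L : sparse) (i j : nat) : R := odflt 0 (nth None (nth [::] L i) j).

Definition minor (n j : nat) (L : sparse) : sparse :=
  [seq mkseq (fun b => nth None r (bump j b)) n | r <- behead L].

(** Laplace expansion along the first row, which skips the zero entries. *)
Fixpoint sparse_det (n : nat) (L : sparse) : R :=
  if n is n'.+1 then
    foldr (fun j d => if nth None (head [::] L) j is Some c
                      then (-1) ^+ j * c * sparse_det n' (minor n' j L) + d else d)
          0 (iota 0 n)
  else 1.

Lemma sparse_detE n L : (n <= size L)%N ->
  \det (\matrix_(i < n, j < n) entry L i j) = sparse_det n L.
Proof.
elim: n L => [|n IHn] L nL; first by rewrite det_mx00.
rewrite (expand_det_row _ ord0) /sparse_det -/sparse_det.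
pose F j := entry L 0 j * ((-1) ^+ j * sparse_det n (minor n j L)).
transitivity (\sum_(j < n.+1) F j).
  apply: eq_bigr => j _; rewrite mxE /F /cofactor add0n; congr (_ * (_ * _)).
  rewrite -IHn; last by rewrite size_map size_behead -subn1 leq_subRL // (leq_trans _ nL).
  congr (\det _); apply/matrixP => a b; rewrite !mxE /entry /minor.
  rewrite lift0 (nth_map [::]) ?size_behead; last first.
    by rewrite -ltnS (leq_trans _ (leqSpred _)) // (leq_trans _ nL) // ltnS.
  by rewrite nth_mkseq // nth_behead.
rewrite -(big_mkord xpredT F) /index_iota subn0.
elim: (iota 0 n.+1) => [|j l IHl]; first by rewrite big_nil.
rewrite big_cons /= -IHl /F /entry -nth0.
by case: (nth None _ j) => [c|] /=; rewrite ?mul0r ?add0r // mulrCA mulrA.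
Qed.

End SparseDet.

Section Quartic.
Variables (k : fieldType) (char0 : [pchar k] =i pred0) (a b : k).

Let nz := char0_natr_neq0 char0.

Lemma quartic_poly : quartic a b = Poly [:: b ^+ 2 - a; -1; - (2 * b); 0; 1].
Proof. by rewrite /quartic /= !cons_poly_def -!mul_polyC; ring. Qed.

Lemma size_quartic : size (quartic a b) = 5.
Proof. by rewrite quartic_poly (PolyK (c := 0)) //= oner_eq0. Qed.

Lemma lead_quartic : lead_coef (quartic a b) = 1.
Proof. by rewrite lead_coefE size_quartic quartic_poly coef_Poly. Qed.

Lemma deriv_quartic : (quartic a b)^`() = Poly [:: -1; - (4 * b); 0; 4].
Proof.
rewrite quartic_poly; apply/polyP => i; rewrite coef_deriv !coef_Poly.
by case: i => [|[|[|[|i]]]] /=; rewrite ?nth_nil ?mul0rn //; ring.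
Qed.

Lemma size_deriv_quartic : size (quartic a b)^`() = 4.
Proof. by rewrite deriv_quartic (PolyK (c := 0)) //= (nz 3). Qed.

Lemma horner_quartic t : (quartic a b).[t] = quartic_at a b t.
Proof. by rewrite quartic_poly horner_Poly /quartic_at /=; ring. Qed.

Lemma horner_deriv_quartic t :
  ((quartic a b)^`()).[t] = 4 * t ^+ 3 - 4 * b * t - 1.
Proof. by rewrite deriv_quartic horner_Poly /=; ring. Qed.

Lemma Delta_resultant : Delta a b = resultant (quartic a b) (quartic a b)^`().
Proof.
by rewrite /Delta /discriminant lead_quartic divr1 size_quartic -signr_odd mul1r.
Qed.

(** The Sylvester matrix is 7 x 7; its determinant is expanded along rows. *)
Lemma Delta_formula : Delta a b = - 27 - 256 * a ^+ 3 + 288 * a * b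
  + 256 * a ^+ 2 * b ^+ 2 - 256 * b ^+ 3.
Proof.
rewrite Delta_resultant.
pose c := b ^+ 2 - a.
pose S x : option k := Some x.
pose p := [:: S c; S (-1); S (- (2 * b)); None; S 1].
pose q := [:: S (-1); S (- (4 * b)); None; S 4].
pose L := [:: p ++ [:: None; None]; None :: p ++ [:: None]; None :: None :: p;
  q ++ [:: None; None; None]; None :: q ++ [:: None; None];
  None :: None :: q ++ [:: None]; None :: None :: None :: q].
transitivity (\det (\matrix_(i < 7, j < 7) entry L i j)).
  rewrite /resultant.
  pose Syl (m n : nat) (P T : {poly k}) : 'M[k]_(n + m) := \matrix_(i, j)
    match split i with inl l => P`_(j - l) *+ (l <= j)%N
    | inr l => T`_(j - l) *+ (l <= j)%N end.
  have -> (P T : {poly k}) : Sylvester_mx P T = Syl (size P).-1 (size T).-1 P T.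
    by apply/matrixP => i j; rewrite Sylvester_mxE mxE.
  rewrite size_quartic size_deriv_quartic deriv_quartic quartic_poly.
  congr (\det _); apply/matrixP => i j; rewrite !mxE /entry.
  have pc l : (l <= j)%N -> (Poly [:: c; -1; - (2 * b); 0; 1] : {poly k})`_(j - l) =
      odflt 0 (nth None (nseq l None ++ p) j).
    move=> lj; rewrite coef_Poly nth_cat size_nseq ltnNge lj /=.
    by case: (j - l)%N => [|[|[|[|[|d]]]]] //=; rewrite !nth_nil.
  have qc l : (l <= j)%N -> (Poly [:: -1; - (4 * b); 0; 4] : {poly k})`_(j - l) =
      odflt 0 (nth None (nseq l None ++ q) j).
    move=> lj; rewrite coef_Poly nth_cat size_nseq ltnNge lj /=.
    by case: (j - l)%N => [|[|[|[|d]]]] //=; rewrite !nth_nil.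
  have pad l r m : nth None (nseq l None ++ r ++ nseq m None) j =
      nth None (nseq l None ++ r) j :> option k.
    by rewrite catA nth_cat; case: ltnP => // jl; rewrite nth_nseq if_same nth_default.
  have lt0 l (r : seq (option k)) : (l <= j)%N = false -> nth None (nseq l None ++ r) j = None.
    by move=> lj; rewrite nth_cat size_nseq ltnNge lj /= nth_nseq if_same.
  have LE : L = [seq nseq l None ++ p ++ nseq (2 - l) None | l <- iota 0 3] ++
      [seq nseq l None ++ q ++ nseq (3 - l) None | l <- iota 0 4] by [].
  rewrite LE nth_cat size_map size_iota.
  case: splitP => l il.
    rewrite {1}il ltn_ord (nth_map 0%N) ?size_iota // ?il // nth_iota // pad.
    by case E: (l <= j)%N; [rewrite pc|rewrite lt0].
  rewrite ifF; last by rewrite il ltnNge leq_addr.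
  rewrite il addKn (nth_map 0%N) ?size_iota //.
  rewrite nth_iota // pad.
  by case E: (l <= j)%N; [rewrite qc|rewrite lt0].
rewrite sparse_detE // /sparse_det /minor /=.
rewrite /c; ring.
Qed.

End Quartic.

(** * The roots of the quartic *)

Section ClosedQuartic.
Variables (k : closedFieldType) (char0 : [pchar k] =i pred0) (a b : k).

Let nz : forall n, (n.+1%:R : k) != 0 := char0_natr_neq0 char0.

Lemma Delta_neq0_simple_roots : Delta a b <> 0 ->
  exists t1 t2 t3 t4, uniq [:: t1; t2; t3; t4] /\
    forall t, t \in [:: t1; t2; t3; t4] -> quartic_at a b t = 0.
Proof.
rewrite Delta_resultant => /eqP; rewrite resultant_eq0 -leqNgt => cop.
have [r rE] := closed_field_poly_normal (quartic a b).
rewrite lead_quartic scale1r in rE.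
have sr : size r = 4.
  by have := size_quartic a b; rewrite rE size_prod_XsubC => -[].
have ru : uniq r.
  rewrite -separable_prod_XsubC -rE unlock /coprimep eqn_leq cop lt0n size_poly_eq0.
  by rewrite gcdp_eq0 -size_poly_eq0 size_quartic.
have r0 t : t \in r -> quartic_at a b t = 0.
  by rewrite -root_prod_XsubC -rE => /eqP; rewrite horner_quartic.
case: r sr ru r0 {rE} => [|t1 [|t2 [|t3 [|t4 []]]]] // _ ru r0.
by exists t1, t2, t3, t4.
Qed.

Lemma Delta_eq0_double_root : Delta a b = 0 ->
  exists r, quartic_at a b r = 0 /\ 4 * r ^+ 3 - 4 * b * r - 1 = 0.
Proof.
rewrite Delta_resultant => /eqP; rewrite resultant_eq0 => /ltn_eqF.
rewrite eq_sym => /negbT /closed_rootP[r]; rewrite root_gcd => /andP[/eqP r0 /eqP r1].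
by exists r; rewrite -horner_quartic -(horner_deriv_quartic a b).
Qed.

(** The parameters for which the quartic has a triple root. *)
Definition triple_root_params : Prop := exists mu : k,
  [/\ mu ^+ 3 = 1, a = 3 / 4 * mu & b = 3 / 4 * mu ^+ 2].

Lemma triple_root r : quartic_at a b r = 0 -> 4 * r ^+ 3 - 4 * b * r - 1 = 0 ->
  b = 3 * r ^+ 2 -> triple_root_params.
Proof.
move=> r0 r1 bE.
have mu3 : -8 * r ^+ 3 = 1.
  by apply/eqP; rewrite -subr_eq0 -[X in _ == X]r1 bE; apply/eqP; ring.
have n4 : (4 : k) != 0 := nz 3.
(* mu = - 2 r, since 4 r^3 - 12 r^3 = 1 gives (- 2 r)^3 = 1 *)
exists (- 2 * r); split.
- by rewrite -[RHS]mu3; ring.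
- have -> : a = 4 * r ^+ 4 - r.
    by apply/eqP; rewrite eq_sym -subr_eq0 -[X in _ == X]r0 /quartic_at bE; apply/eqP; ring.
  apply: (mulfI n4).
  transitivity (- 2 * r * (- 8 * r ^+ 3) - 4 * r); first by ring.
  by rewrite mu3; field.
- by rewrite bE; field.
Qed.

Lemma triple_rootE : triple_root_params -> exists r,
  [/\ quartic_at a b r = 0, 4 * r ^+ 3 - 4 * b * r - 1 = 0, b = 3 * r ^+ 2 & r != 0].
Proof.
have n4 : (4 : k) != 0 := nz 3. have n2 : (2 : k) != 0 := nz 1.
move=> [mu [mu3 aE bE]]; exists (- mu / 2); split.
- rewrite /quartic_at aE bE.
  transitivity (mu / 4 * (mu ^+ 3 - 1)); last by rewrite mu3 subrr mulr0.
  by field; rewrite ?n2 ?n4.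
- rewrite bE; transitivity (mu ^+ 3 - 1); last by rewrite mu3 subrr.
  by field; rewrite ?n2 ?n4.
- by rewrite bE; field; rewrite ?n2 ?n4.
- rewrite mulf_neq0 ?invr_neq0 ?oppr_eq0 //.
  by apply: contra_eqN mu3 => /eqP ->; rewrite expr0n eq_sym oner_eq0.
Qed.

(** If r is a double but not a triple root, the other two roots are
    d - r and - d - r, where d^2 = 2 (b - r^2). *)
Lemma double_root_others r : quartic_at a b r = 0 ->
  4 * r ^+ 3 - 4 * b * r - 1 = 0 -> ~ triple_root_params ->
  exists t1 t2, [/\ quartic_at a b t1 = 0, quartic_at a b t2 = 0,
     t1 != r, t2 != r & t1 != t2].
Proof.
move=> r0 r1 ntriple; have n2 : (2 : k) != 0 := nz 1.
have [d dE] := sqrt_exists (2 * (b - r ^+ 2)).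
(* the cofactor of (t - r)^2 is (t + r)^2 - d^2 *)
have fac t : quartic_at a b t = (t - r) ^+ 2 * ((t + r) ^+ 2 - d ^+ 2).
  rewrite dE; apply/eqP; rewrite -subr_eq0; apply/eqP.
  transitivity (quartic_at a b r + (t - r) * (4 * r ^+ 3 - 4 * b * r - 1)).
    by rewrite /quartic_at; ring.
  by rewrite r0 r1 mulr0 addr0.
have nd : d ^+ 2 != (2 * r) ^+ 2.
  rewrite dE; apply/eqP => E; apply: ntriple; apply: (triple_root r0 r1).
  apply: (mulfI n2); transitivity (2 * (b - r ^+ 2) + 2 * r ^+ 2); first by ring.
  by rewrite E; ring.
exists (d - r), (- d - r); split.
- by rewrite fac; ring.
- by rewrite fac; ring.
- apply: contraNneq nd => E; apply/eqP.
  suff -> : d = 2 * r by [].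
  by transitivity (d - r + r); [ring|rewrite E; ring].
- apply: contraNneq nd => E; apply/eqP.
  rewrite -sqrrN; suff -> : - d = 2 * r by [].
  by transitivity (- d - r + r); [ring|rewrite E; ring].
- apply/eqP => E.
  have d0 : d = 0.
    by apply: (mulf_id0 n2); transitivity (d - r - (- d - r)); [ring|rewrite E subrr].
  have bE : b = r ^+ 2.
    apply/eqP; rewrite -subr_eq0; apply/eqP; apply: (mulf_id0 n2).
    by rewrite -dE d0 expr0n.
  by move/eqP: r1; rewrite bE -mulrA -exprSr subrr sub0r oppr_eq0 oner_eq0.
Qed.

End ClosedQuartic.

(** * The table of conics *)

Section Forms.
Variable k : fieldType.

Lemma gen_sqr (i : 'I_3) : free_gen k i ^+ 2 = gen2 k i i.
Proof. by rewrite gen2E. Qed.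

Lemma rel_S_skew : rel_S k = skew_rels 0 0.
Proof. by rewrite /skew_rels !scale0r !addr0 gen2E. Qed.

Lemma rel_S'_skew : rel_S' k = skew_rels 1 0.
Proof. by rewrite /skew_rels !scale0r !addr0 !scale1r gen2E. Qed.

Lemma rel_N_skew : rel_N k = skew_rels 1 1.
Proof. by rewrite /skew_rels !scale1r gen2E. Qed.

Local Notation x := (fx k).
Local Notation y := (fy k).
Local Notation z := (fz k).

Lemma form_x : x ^+ 2 = diag_form 1 0 0.
Proof. by rewrite /diag_form !scale0r !addr0 scale1r gen_sqr. Qed.

Lemma form_xy (a : k) : a *: x ^+ 2 + y ^+ 2 = diag_form a 1 0.
Proof. by rewrite /diag_form scale0r addr0 scale1r !gen_sqr. Qed.

Lemma form_xyz (a b : k) : a *: x ^+ 2 + b *: y ^+ 2 + z ^+ 2 = diag_form a b 1.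
Proof. by rewrite /diag_form scale1r !gen_sqr. Qed.

End Forms.

(* decides identities between k-combinations of polynomials *)
Ltac mpoly_ring :=
  rewrite /rel_u /rel_v /px /py /pz /= -?mul_mpolyC; ring.

Theorem theorem4p8 (k : closedFieldType) (char0 : [pchar k] =i pred0)
    (alpha beta : k) :
  let x := fx k in let y := fy k in let z := fz k in
  let X := px k in let Y := py k in let Z := pz k in
  [/\
    (* S *)
    [/\ conic_is (rel_S k) (x ^+ 2) [:: Y ^+ 2; Z ^+ 2] (trunc_uv k),
        conic_is (rel_S k) (x ^+ 2 + y ^+ 2)
          [:: X ^+ 2 - Y ^+ 2; Z ^+ 2] (trunc k 2 * trunc k 2)%type
      & conic_is (rel_S k) (x ^+ 2 + y ^+ 2 + z ^+ 2)
          [:: X ^+ 2 - Y ^+ 2; X ^+ 2 - Z ^+ 2] (k4 k)],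
    (* S' *)
    [/\ conic_is (rel_S' k) (x ^+ 2) [:: Y ^+ 2; Z ^+ 2] (trunc_uv k),
        conic_is (rel_S' k) (y ^+ 2) [:: X ^+ 2 - Y * Z; Z ^+ 2] (trunc k 4),
        conic_is (rel_S' k) (x ^+ 2 + y ^+ 2)
          [:: X ^+ 2 - Y * Z - Y ^+ 2; Z ^+ 2] (trunc k 2 * trunc k 2)%type
      & let f := alpha *: x ^+ 2 + y ^+ 2 + z ^+ 2 in
        [/\ qdual_is (f :: rel_S' k)
              [:: Y ^+ 2 - Z ^+ 2; X ^+ 2 - Y * Z - alpha *: Y ^+ 2],
            alpha = 1 \/ alpha = -1 ->
              C_is (rel_S' k) f (trunc k 2 * k2 k)%type
          & ~ (alpha = 1 \/ alpha = -1) -> C_is (rel_S' k) f (k4 k)]],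
    (* N *)
    let f := alpha *: x ^+ 2 + y ^+ 2 in
    [/\ qdual_is (f :: rel_N k)
          [:: X ^+ 2 - Y * Z - alpha *: (Y ^+ 2 - X * Z); Z ^+ 2],
        alpha = 0 -> C_is (rel_N k) f (trunc k 4)
      & alpha <> 0 -> C_is (rel_N k) f (trunc k 2 * trunc k 2)%type],
    let f := alpha *: x ^+ 2 + beta *: y ^+ 2 + z ^+ 2 in
    let triple := exists mu : k,
      [/\ mu ^+ 3 = 1, alpha = 3 / 4 * mu & beta = 3 / 4 * mu ^+ 2] in
    [/\ qdual_is (f :: rel_N k)
          [:: X ^+ 2 - Y * Z - alpha *: Z ^+ 2;
              Y ^+ 2 - X * Z - beta *: Z ^+ 2],
        Delta alpha beta <> 0 -> C_is (rel_N k) f (k4 k),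
        triple -> C_is (rel_N k) f (trunc k 3 * k^o)%type
      & Delta alpha beta = 0 -> ~ triple ->
          C_is (rel_N k) f (trunc k 2 * k2 k)%type]
  & Delta alpha beta = - 27 - 256 * alpha ^+ 3 + 288 * alpha * beta
      + 256 * alpha ^+ 2 * beta ^+ 2 - 256 * beta ^+ 3].
Proof.
move=> x y z X Y Z; rewrite {}/X {}/Y {}/Z.
have kinf := char0_poly_eq0 char0.
have two : (2 : k) != 0 := char0_natr_neq0 char0 1.
have sum_xy : x ^+ 2 + y ^+ 2 = diag_form 1 1 0 by rewrite -form_xy scale1r.
split.
- rewrite rel_S_skew; split.
  + rewrite form_x; apply: (conic_x kinf _ _ (model_x_uv k)).
    by apply: (ideal_gens2 (a1 := 1) (a2 := 0) (b1 := 0) (b2 := 1)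
      (c1 := 1) (c2 := 0) (d1 := 0) (d2 := 1)); mpoly_ring.
  + rewrite sum_xy; have [U [V m]] := model_y_two two 0 0 (oner_neq0 k).
    rewrite expr1n in m; apply: (conic_y kinf _ m).
    by apply: (ideal_gens2 (a1 := 1) (a2 := 0) (b1 := 0) (b2 := 1)
      (c1 := 1) (c2 := 0) (d1 := 0) (d2 := 1)); mpoly_ring.
  + rewrite -[x ^+ 2]scale1r -[y ^+ 2]scale1r form_xyz.
    have [||U [V m]] := @model_z_points k two 0 1 1 1 _ _ (oner_neq0 k) (oner_neq0 k);
      rewrite ?addr0 ?subr0 ?expr1n //.
    apply: (conic_z kinf _ m).
    by apply: (ideal_gens2 (a1 := 0) (a2 := 1) (b1 := -1) (b2 := 1)
      (c1 := 1) (c2 := -1) (d1 := 1) (d2 := 0)); mpoly_ring.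
- rewrite rel_S'_skew; split.
  + rewrite form_x; apply: (conic_x kinf _ _ (model_x_uv k)).
    by apply: (ideal_gens2 (a1 := 1) (a2 := 0) (b1 := 0) (b2 := 1)
      (c1 := 1) (c2 := 0) (d1 := 0) (d2 := 1)); mpoly_ring.
  + rewrite -[y ^+ 2]add0r -(scale0r (x ^+ 2)) form_xy.
    have [U [V m]] := model_y_quartic (0 : k); apply: (conic_y kinf _ m).
    by apply: (ideal_gens2 (a1 := 1) (a2 := 0) (b1 := 0) (b2 := 1)
      (c1 := 1) (c2 := 0) (d1 := 0) (d2 := 1)); mpoly_ring.
  + rewrite sum_xy; have [U [V m]] := model_y_two two 1 0 (oner_neq0 k).
    rewrite expr1n in m; apply: (conic_y kinf _ m).
    by apply: (ideal_gens2 (a1 := 1) (a2 := 0) (b1 := 0) (b2 := 1)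
      (c1 := 1) (c2 := 0) (d1 := 0) (d2 := 1)); mpoly_ring.
  + rewrite /= -[y ^+ 2]scale1r form_xyz.
    have gens : ideal_gens (rels_z 1 0 alpha 1) i2 i0 i1
        [:: py k ^+ 2 - pz k ^+ 2; px k ^+ 2 - py k * pz k - alpha *: py k ^+ 2].
      by apply: (ideal_gens2 (a1 := alpha) (a2 := 1) (b1 := 1) (b2 := 0)
        (c1 := 0) (c2 := 1) (d1 := 1) (d2 := - alpha)); mpoly_ring.
    have dbl : alpha = 1 \/ alpha = -1 ->
        exists U V, @conic_model k (rels_z 1 0 alpha 1) (trunc k 2 * k2 k)%type U V.
      move=> a1; have [r rE] := sqrt_exists (- 2 * (- alpha)).
      have a2 : (- alpha) ^+ 2 = 1 by case: a1 => ->; rewrite ?sqrrN expr1n.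
      have r0 : r != 0.
        rewrite -sqrf_eq0 rE mulf_neq0 ?oppr_eq0 // -sqrf_eq0 -sqrrN a2.
        exact: oner_neq0.
      by have [U [V m]] := model_z_double two a2 rE r0; rewrite opprK in m; exists U, V.
    have simple : ~ (alpha = 1 \/ alpha = -1) ->
        exists U V, @conic_model k (rels_z 1 0 alpha 1) (k4 k) U V.
      move=> a1; have [p pE] := sqrt_exists (alpha + 1).
      have [m mE] := sqrt_exists (alpha - 1).
      apply: (model_z_points two pE mE).
        rewrite -sqrf_eq0 pE addr_eq0; apply/eqP => a; by apply: a1; right.
      rewrite -sqrf_eq0 mE subr_eq0; apply/eqP => a; by apply: a1; left.
    split.
    * have [/dbl|/simple] := boolp.EM (alpha = 1 \/ alpha = -1);
        by move=> [U [V m]]; apply: (conic_z kinf gens m).1.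
    * by move=> /dbl[U [V m]]; apply: (conic_z kinf gens m).2.
    * by move=> /simple[U [V m]]; apply: (conic_z kinf gens m).2.
- rewrite /= rel_N_skew form_xy.
  have gens : ideal_gens (rels_y 1 1 alpha) i1 i0 i2
      [:: px k ^+ 2 - py k * pz k - alpha *: (py k ^+ 2 - px k * pz k); pz k ^+ 2].
    by apply: (ideal_gens2 (a1 := 1) (a2 := 0) (b1 := 0) (b2 := 1)
      (c1 := 1) (c2 := 0) (d1 := 0) (d2 := 1)); mpoly_ring.
  have quad : alpha = 0 -> exists U V, @conic_model k (rels_y 1 1 alpha) (trunc k 4) U V.
    by move=> ->; apply: model_y_quartic.
  have two_pts : alpha <> 0 ->
      exists U V, @conic_model k (rels_y 1 1 alpha) (trunc k 2 * trunc k 2)%type U V.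
    move=> /eqP a0; have [r rE] := sqrt_exists alpha; rewrite -rE; apply: model_y_two => //.
    by rewrite -sqrf_eq0 rE.
  split.
  + have [/quad|/eqP/two_pts] := eqVneq alpha 0;
      by move=> [U [V m]]; apply: (conic_y kinf gens m).1.
  + by move=> /quad[U [V m]]; apply: (conic_y kinf gens m).2.
  + by move=> /two_pts[U [V m]]; apply: (conic_y kinf gens m).2.
- rewrite /= rel_N_skew form_xyz.
  have gens : ideal_gens (rels_z 1 1 alpha beta) i2 i0 i1
      [:: px k ^+ 2 - py k * pz k - alpha *: pz k ^+ 2; py k ^+ 2 - px k * pz k - beta *: pz k ^+ 2].
    by apply: (ideal_gens2 (a1 := 1) (a2 := 0) (b1 := 0) (b2 := 1)
      (c1 := 1) (c2 := 0) (d1 := 0) (d2 := 1)); mpoly_ring.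
  have simple : Delta alpha beta <> 0 ->
      exists U V, @conic_model k (rels_z 1 1 alpha beta) (k4 k) U V.
    move=> /Delta_neq0_simple_roots[t1 [t2 [t3 [t4 [tu t0]]]]].
    exact: model_quartic_simple tu t0.
  have trip : triple_root_params alpha beta ->
      exists U V, @conic_model k (rels_z 1 1 alpha beta) (trunc k 3 * k^o)%type U V.
    move=> /(triple_rootE char0)[r [r0 r1 bE rn0]].
    exact: model_quartic_triple r0 two rn0 r1 bE.
  have dbl : Delta alpha beta = 0 -> ~ triple_root_params alpha beta ->
      exists U V, @conic_model k (rels_z 1 1 alpha beta) (trunc k 2 * k2 k)%type U V.
    move=> /Delta_eq0_double_root[r [r0 r1]] /(double_root_others char0 r0 r1).
    move=> [t1 [t2 [t10 t20 t1r t2r t12]]].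
    exact: model_quartic_double r0 r1 t10 t20 t1r t2r t12.
  split.
  + have [/dbl D0|/eqP/simple[U [V m]]] := eqVneq (Delta alpha beta) 0; last first.
      exact: (conic_z kinf gens m).1.
    have [/trip|/D0] := boolp.EM (triple_root_params alpha beta);
      by move=> [U [V m]]; apply: (conic_z kinf gens m).1.
  + by move=> /simple[U [V m]]; apply: (conic_z kinf gens m).2.
  + by move=> /trip[U [V m]]; apply: (conic_z kinf gens m).2.
  + by move=> /dbl d /d[U [V m]]; apply: (conic_z kinf gens m).2.
- exact: Delta_formula char0 _ _.
Qed.
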